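(* Let $M$ be an even positive integer, $h_0,\dots,h_{M-1}$ the filter coefficients of a wavelet of order $M$, and let $n,d$ be positive integers with $d\le n$ (and $2^{n-d+1}\ge M$). Then the $d$-level quantum wavelet transform $W^{(d)}_n$ on $n$ qubits can be implemented exactly using $\lceil\log_2M\rceil+2$ ancilla qubits and $\mathcal{O}(dn)+\mathcal{O}(dM^{3/2})$ Toffoli gates and elementary one- and two-qubit gates. *)

(* Defs.v *)
From HB Require Import structures.
From mathcomp Require Import all_boot all_order all_algebra.
From mathcomp Require Import reals.
From mathcomp.real_closed Require Import complex.

Set Implicit Arguments.
Unset Strict Implicit.
Unset Printing Implicit Defensive.

Import Order.TTheory GRing.Theory Num.Theory.
Local Open Scope ring_scope.
Local Open Scope complex_scope.

(* A register of N qubits has computational basis indexed by 'I_(2^N);       *)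
(* qubit q of basis index z is the bit  odd (z %/ 2^q).                      *)

Definition qbit (z q : nat) : bool := odd (z %/ 2 ^ q).

(* the index (in 'I_(2^k)) of the restriction of basis index z to the
   qubits listed in qs (qs_0 is the least significant bit) *)
Definition subidx (qs : seq nat) (z : nat) : nat :=
  \sum_(j < size qs) (qbit z (nth 0 qs j)) * 2 ^ j.

Definition agree_outside (N : nat) (qs : seq nat) (z z' : nat) : bool :=
  [forall q : 'I_N, (val q \notin qs) ==> (qbit z q == qbit z' q)].

Section Circuits.
Variable R : realType.
Local Notation C := (R[i]).

Definition adjmx (m : nat) (A : 'M[C]_m) : 'M[C]_m := (map_mx Num.conj A)^T.
Definition unitary_mx (m : nat) (A : 'M[C]_m) : Prop := A *m adjmx A = 1%:M.

(* the action on N qubits of a k-qubit matrix U applied to the qubits qs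
   (a list of k distinct qubits), identity on the other qubits *)
Definition embed (N k : nat) (qs : seq nat) (U : 'M[C]_(2 ^ k)) : 'M[C]_(2 ^ N) :=
  \matrix_(r, c)
    if agree_outside N qs r c then
      \sum_(a < 2 ^ k) \sum_(b < 2 ^ k)
         (if (val a == subidx qs r) && (val b == subidx qs c) then U a b else 0)
    else 0.

(* Toffoli gate on 3 qubits: qubits 0,1 are controls, qubit 2 the target,
   i.e. basis states 3 (=011b) and 7 (=111b) are swapped *)
Definition toffoli_perm (i : nat) : nat :=
  if i == 3%N then 7%N else if i == 7%N then 3%N else i.
Definition toffoli_mx : 'M[C]_(2 ^ 3) :=
  \matrix_(r, c) (val c == toffoli_perm r)%:R.

Inductive gate (N : nat) :=
  | G1 of 'I_N & 'M[C]_(2 ^ 1)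
  | G2 of 'I_N & 'I_N & 'M[C]_(2 ^ 2)
  | Toffoli of 'I_N & 'I_N & 'I_N.

Definition gate_ok (N : nat) (g : gate N) : Prop :=
  match g with
  | G1 _ U => unitary_mx U
  | G2 q1 q2 U => q1 != q2 /\ unitary_mx U
  | Toffoli c1 c2 t => uniq [:: c1; c2; t]
  end.

Definition gate_mx (N : nat) (g : gate N) : 'M[C]_(2 ^ N) :=
  match g with
  | G1 q U => embed N [:: val q] U
  | G2 q1 q2 U => embed N [:: val q1; val q2] U
  | Toffoli c1 c2 t => embed N [:: val c1; val c2; val t] toffoli_mx
  end.

Definition circuit N := seq (gate N).

Fixpoint circuit_ok N (cc : circuit N) : Prop :=
  match cc with [::] => True | g :: cc' => gate_ok g /\ circuit_ok cc' end.

Definition circuit_mx N (cc : circuit N) : 'M[C]_(2 ^ N) :=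
  foldl (fun A g => gate_mx g *m A) 1%:M cc.

(* The circuit on n data qubits (qubits 0..n-1) plus a ancilla qubits
   (qubits n..n+a-1) implements W exactly: for every data basis state x
   with the ancillas in |0..0>, the output is (W|x>) (x) |0..0>.
   Basis indices z < 2^n are exactly those with all ancillas 0. *)
Definition implements (n a : nat) (cc : circuit (n + a)) (W : 'M[C]_(2 ^ n)) : Prop :=
  forall z x : 'I_(2 ^ (n + a)), (x < 2 ^ n)%N ->
    circuit_mx cc z x =
      (if insub (val z) is Some z' then
         (if insub (val x) is Some x' then W z' x' else 0)
       else 0).

(* h_0..h_(M-1) (h i for i >= M is ignored) are the filter coefficients of a
   (orthonormal, compactly supported) wavelet of order M *)
Definition wavelet_filter (M : nat) (h : nat -> R) : Prop :=
  \sum_(i < M) h i = Num.sqrt 2 /\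
  forall k : nat,
    \sum_(i < M) (if (i + 2 * k < M)%N then h i * h (i + 2 * k)%N else 0)
      = (k == 0%N)%:R.

Definition wavelet_g (M : nat) (h : nat -> R) (i : nat) : R :=
  (-1) ^+ i * h (M.-1 - i)%N.

Definition wavelet1_entry (M : nat) (h : nat -> R) (m r c : nat) : C :=
  let N := (2 ^ m)%N in
  let H := (N %/ 2)%N in
  if (r < H)%N then
    \sum_(i < M) (if c == ((2 * r + i) %% N)%N then (h i)%:C else 0)
  else
    \sum_(i < M) (if c == ((2 * (r - H) + i) %% N)%N then (wavelet_g M h i)%:C else 0).

Definition wavelet_level (M : nat) (h : nat -> R) (n m : nat) : 'M[C]_(2 ^ n) :=
  \matrix_(r, c)
    if (r < 2 ^ m)%N && (c < 2 ^ m)%N then wavelet1_entry M h m r c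
    else (val r == val c)%:R.

Fixpoint qwt (M : nat) (h : nat -> R) (n d : nat) : 'M[C]_(2 ^ n) :=
  match d with
  | 0 => 1%:M
  | d'.+1 => wavelet_level M h n (n - d') *m qwt M h n d'
  end.

End Circuits.

(* Main.v *)
(* Write alpha_j = h_(2j), beta_j = h_(2j+1) and J = M/2 - 1. Orthonormality of
   the filter makes the 2 x 2 polyphase matrix paraunitary, so it splits into
   J + 1 plane rotations separated by unit delays: one level of the transform
   is a permutation times G_J ... G_0, where G_t rotates the pairs formed by
   the sample 2p and the sample 2(p + t) + 1.

   Shifting the whole register between two rotations would cost O(Mn) gates.
   Instead cut the positions p into blocks of length L = 2^l >= M/2. A rotation
   of G_t either stays inside a block (part A_t) or joins a block to the next
   one (part B_t), and B_t commutes with every A_t' with t' >= t because the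
   two act on disjoint samples. Hence G_J ... G_0 = (B_J ... B_0)(A_J ... A_0).
   The A part only needs shifts modulo L, that is, of l qubits; after moving
   the odd samples by one whole block the same is true of the B part. One level
   thus costs O(M log M) gates on l qubits, and a bounded number of permutations
   of the whole register (block shift, bit rotation, test that the upper
   qubits vanish), each of which takes O(n) gates. The latter are built from
   the Cuccaro ripple adder, used with borrowed qubits: adding g and then its
   complement plus one is the identity, so the value of g does not matter. *)
Require Import Defs.
From HB Require Import structures.
From mathcomp Require Import all_boot all_order all_algebra.
From mathcomp Require Import reals boolp.
From mathcomp.real_closed Require Import complex.
From mathcomp Require Import zify ring.
Import Order.TTheory GRing.Theory Num.Theory.
Set Implicit Arguments.
Unset Strict Implicit.
Unset Printing Implicit Defensive.

(** * Registers as bit assignments *)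

(** The supply of ancillas shapes the circuits. Only [l + 3] are available, where [l + 1] is the
    logarithm of [M] rounded up: enough for a clean register as long as the position inside a block,
    not for one as long as the block number or the upper qubits. Operations inside a block therefore
    use clean ancillas, while those on up to [n] qubits borrow data qubits, each half of a register
    serving the other. The block shift of the B part is never undone: it is corrected on some of the
    odd samples and absorbed by the closing permutation. For [M = 2] no ancilla is left for this
    correction, but then every pair lies inside its block and the B part is empty. Between gates the
    ancillas hold flags, so circuits are specified on states whose ancillas are functions of the
    data index; matrices enter through the images of basis vectors. The exponent 3/2 comes from
    [M log M] and [log M <= 4 sqrt M]. *)

Definition state := nat -> bool.

Definition upd (s : state) (q : nat) (b : bool) : state :=
  fun j => if j == q then b else s j.

Definition bval (s : state) (qs : seq nat) : nat :=
  foldr (fun q v => s q + 2 * v) 0 qs.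

Definition setb (s : state) (qs : seq nat) (v : nat) : state :=
  fun j => if j \in qs then qbit v (index j qs) else s j.

Lemma qbit0 v : qbit v 0 = odd v.
Proof. by rewrite /qbit divn1. Qed.

Lemma qbitS v j : qbit v j.+1 = qbit v./2 j.
Proof. by rewrite /qbit expnS divnMA -divn2. Qed.

Lemma qbit_zero j : qbit 0 j = false.
Proof. by rewrite /qbit div0n. Qed.

Lemma half_bit (b : bool) v : (b + 2 * v)./2 = v.
Proof. by rewrite mul2n half_bit_double. Qed.

Lemma odd_bit (b : bool) v : odd (b + 2 * v) = b.
Proof. by rewrite mul2n oddD odd_double addbF; case: b. Qed.

Lemma bit_half x : odd x + 2 * x./2 = x.
Proof. by rewrite mul2n odd_double_half. Qed.

Lemma half_modX v k : (v %% 2 ^ k.+1)./2 = v./2 %% 2 ^ k.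
Proof.
rewrite -!divn2 expnS; apply/eqP.
have p2 : 0 < 2 ^ k by rewrite expn_gt0.
have e : v = (v %/ 2 %/ 2 ^ k * 2 ^ k + v %/ 2 %% 2 ^ k) * 2 + v %% 2.
  by rewrite -!divn_eq.
have lt1 : v %/ 2 %% 2 ^ k < 2 ^ k by rewrite ltn_mod.
have lt2 : v %% 2 < 2 by rewrite ltn_mod.
rewrite {1}e.
have -> : (v %/ 2 %/ 2 ^ k * 2 ^ k + v %/ 2 %% 2 ^ k) * 2 + v %% 2
  = v %/ 2 %/ 2 ^ k * (2 * 2 ^ k) + (v %/ 2 %% 2 ^ k * 2 + v %% 2) by ring.
rewrite modnMDl modn_small; last by lia.
by rewrite divnMDl // [_ %% 2 %/ 2]divn_small // addn0.
Qed.

Lemma odd_modX v k : odd (v %% 2 ^ k.+1) = odd v.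
Proof.
have : v %% 2 ^ k.+1 %% 2 = v %% 2 by rewrite modn_dvdm // expnS dvdn_mulr.
by rewrite !modn2; do 2 case: odd.
Qed.

Lemma qbit_modX v k j : j < k -> qbit (v %% 2 ^ k) j = qbit v j.
Proof.
elim: j k v => [|j IH] [|k] v //= lt_jk; rewrite ?qbit0 ?odd_modX //.
by rewrite !qbitS half_modX IH.
Qed.

Lemma qbit_small v k j : v < 2 ^ k -> k <= j -> qbit v j = false.
Proof.
move=> ltv lekj; rewrite /qbit divn_small //.
by apply: (leq_trans ltv); rewrite leq_exp2l.
Qed.

Lemma qbit_cat a b k j : a < 2 ^ k ->
  qbit (a + 2 ^ k * b) j = if j < k then qbit a j else qbit b (j - k).
Proof.
move=> lta; case: ltnP => h.
  by rewrite -(qbit_modX (a + _) h) mulnC addnC modnMDl modn_small.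
rewrite /qbit -{1}(subnKC h) expnD divnMA mulnC divnDMl ?expn_gt0 //.
by rewrite [a %/ _]divn_small.
Qed.

Lemma qbit_inj a b k : a < 2 ^ k -> b < 2 ^ k ->
  (forall j, j < k -> qbit a j = qbit b j) -> a = b.
Proof.
elim: k a b => [|k IH] a b; first by rewrite !ltnS !leqn0 => /eqP -> /eqP ->.
rewrite expnS => lta ltb H; rewrite -(bit_half a) -(bit_half b).
have := H 0 (ltn0Sn _); rewrite !qbit0 => ->; congr (_ + 2 * _).
apply: IH => [||j ltj]; try lia.
by rewrite -!qbitS; exact: H.
Qed.

Lemma updE s q b j : upd s q b j = if j == q then b else s j.
Proof. by []. Qed.

Lemma upd_id s q : upd s q (s q) = s.
Proof. by apply/funext => j; rewrite updE; case: eqP => [->|]. Qed.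

Lemma upd_upd s q b b' : upd (upd s q b) q b' = upd s q b'.
Proof. by apply/funext => j; rewrite !updE; case: eqP. Qed.

Lemma bval_ext s s' qs : {in qs, s =1 s'} -> bval s qs = bval s' qs.
Proof.
elim: qs => //= q qs IH H; rewrite H ?mem_head // IH // => j hj.
by apply: H; rewrite inE hj orbT.
Qed.

Lemma bval_upd s q b qs : q \notin qs -> bval (upd s q b) qs = bval s qs.
Proof.
move=> h; apply: bval_ext => j hj; rewrite updE; case: eqP => // e.
by rewrite -e hj in h.
Qed.

Lemma bval_lt s qs : bval s qs < 2 ^ size qs.
Proof. by elim: qs => //= q qs IH; rewrite expnS; case: (s q); lia. Qed.

Lemma bval_cat s ps qs : bval s (ps ++ qs) = bval s ps + 2 ^ size ps * bval s qs.
Proof.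
elim: ps => [|p ps IH] /=; first by rewrite expn0 mul1n.
by rewrite IH expnS; ring.
Qed.

Lemma bval_qbit s qs i : i < size qs -> qbit (bval s qs) i = s (nth 0 qs i).
Proof.
elim: qs i => //= q qs IH [|i] lt_i; rewrite ?qbit0 ?odd_bit //.
by rewrite qbitS half_bit IH.
Qed.

Lemma setb_cons s q qs v : setb s (q :: qs) v = upd (setb s qs v./2) q (odd v).
Proof.
apply/funext => j; rewrite updE /setb inE /= eq_sym.
by case: eqP => _ /=; rewrite ?qbit0 ?qbitS.
Qed.

Lemma setb_nil s v : setb s [::] v = s.
Proof. by apply/funext. Qed.

Lemma setb_out s qs v j : j \notin qs -> setb s qs v j = s j.
Proof. by rewrite /setb => /negPf ->. Qed.

Lemma setb_mod s qs v : setb s qs (v %% 2 ^ size qs) = setb s qs v.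
Proof.
apply/funext => j; rewrite /setb; case: ifP => // hj.
by rewrite qbit_modX // index_mem.
Qed.

Lemma setb_eqm s qs v w : v = w %[mod 2 ^ size qs] -> setb s qs v = setb s qs w.
Proof. by move=> e; rewrite -setb_mod e setb_mod. Qed.

Lemma bval_setb s qs v : uniq qs -> bval (setb s qs v) qs = v %% 2 ^ size qs.
Proof.
move=> uq; apply: (@qbit_inj _ _ (size qs)); rewrite ?bval_lt ?ltn_mod ?expn_gt0 //.
move=> j ltj; rewrite bval_qbit // qbit_modX // /setb mem_nth // index_uniq //.
Qed.

Lemma setb_bval s qs : setb s qs (bval s qs) = s.
Proof.
apply/funext => j; rewrite /setb; case: ifP => // hj.
by rewrite bval_qbit ?index_mem // nth_index.
Qed.

Lemma setb_cat s ps qs v :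
  setb s (ps ++ qs) v = setb (setb s qs (v %/ 2 ^ size ps)) ps v.
Proof.
apply/funext => j; rewrite /setb mem_cat index_cat; case: (boolP (j \in ps)) => //= hj.
by case: ifP => // _; rewrite /qbit -divnMA -expnD.
Qed.

Lemma bval_setb_disj s ps qs v : ~~ has (mem ps) qs ->
  bval (setb s ps v) qs = bval s qs.
Proof.
move=> /hasPn h; apply: bval_ext => j hj; apply: setb_out; exact: h.
Qed.

Lemma bval_iota x a k : bval (qbit x) (iota a k) = (x %/ 2 ^ a) %% 2 ^ k.
Proof.
apply: (@qbit_inj _ _ k).
- by rewrite -{2}(size_iota a k) bval_lt.
- by rewrite ltn_mod expn_gt0.
move=> j ltj; rewrite bval_qbit ?size_iota // nth_iota // qbit_modX //.
by rewrite /qbit -divnMA -expnD.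
Qed.

(** The value-level counterpart of [setb] on consecutive qubits: [x] with its [k] bits from position
    [a] on replaced by those of [v]. *)
Definition setf (a k v x : nat) : nat :=
  x %% 2 ^ a + 2 ^ a * (v %% 2 ^ k + 2 ^ k * (x %/ 2 ^ (a + k))).

Lemma index_iota' a k j : a <= j < a + k -> index j (iota a k) = j - a.
Proof.
move=> /andP[h1 h2]; rewrite -{1}(subnKC h1) -(@nth_iota 0 a k); last by lia.
by rewrite index_uniq ?iota_uniq ?size_iota //; lia.
Qed.

Lemma setb_iota x a k v : setb (qbit x) (iota a k) v = qbit (setf a k v x).
Proof.
apply/funext => j; rewrite /setb mem_iota /setf.
rewrite qbit_cat ?ltn_mod ?expn_gt0 //.
case: (ltnP j a) => h1.
  by rewrite /= qbit_modX.
rewrite /= qbit_cat ?ltn_mod ?expn_gt0 //; case: (ltnP j (a + k)) => h2.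
  rewrite index_iota' ?h1 //; have -> : j - a < k by lia.
  by rewrite qbit_modX //; lia.
have -> : (j - a < k) = false by lia.
rewrite /qbit -divnMA -expnD; congr (odd (_ %/ 2 ^ _)); lia.
Qed.

(** * Reversible arithmetic *)

(* NOT, CNOT and Toffoli; the target is the last argument. *)
Inductive cgate := TX of nat | TC of nat & nat | TT of nat & nat & nat.

Definition cqubits (g : cgate) : seq nat :=
  match g with
  | TX t => [:: t] | TC a t => [:: a; t] | TT a b t => [:: a; b; t]
  end.

Definition ceval (g : cgate) (s : state) : state :=
  match g with
  | TX t => upd s t (~~ s t)
  | TC a t => upd s t (s a (+) s t)
  | TT a b t => upd s t ((s a && s b) (+) s t)
  end.

Definition evals (cs : seq cgate) (s : state) : state :=
  foldl (fun s g => ceval g s) s cs.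

Definition gate_on (qs : seq nat) (g : cgate) : bool :=
  uniq (cqubits g) && all (mem qs) (cqubits g).

Lemma evals_cat cs cs' s : evals (cs ++ cs') s = evals cs' (evals cs s).
Proof. by rewrite /evals foldl_cat. Qed.

Lemma cevalK qs g s : gate_on qs g -> ceval g (ceval g s) = s.
Proof.
rewrite /gate_on => /andP[u _]; apply/funext => j; move: u.
case: g => [t|a t|a b t] /=; rewrite ?inE ?updE ?eqxx.
- by move=> _; case: eqP => // ->; rewrite negbK.
- move=> /andP[/negPf nat _]; rewrite nat; case: eqP => // ->.
  by rewrite addbA addbb.
rewrite negb_or => /andP[/andP[_ /negPf na] /andP[/negPf nb _]].
by rewrite na nb; case: eqP => // ->; rewrite addbA addbb.
Qed.

Lemma evals_revK qs cs s : all (gate_on qs) cs -> evals (rev cs) (evals cs s) = s.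
Proof.
elim: cs s => //= g cs IH s /andP[hg hcs].
by rewrite rev_cons -cats1 evals_cat IH //= (@cevalK qs).
Qed.

Lemma evals_rev qs cs s s' : all (gate_on qs) cs -> evals cs s' = s ->
  evals (rev cs) s = s'.
Proof. by move=> h <-; rewrite (evals_revK _ h). Qed.

Lemma gate_on_sub qs qs' cs : {subset qs <= qs'} -> all (gate_on qs) cs -> all (gate_on qs') cs.
Proof.
move=> sub; apply: sub_all => g; rewrite /gate_on => /andP[-> /=].
by apply: sub_all => j; exact: sub.
Qed.

Lemma ceval_out qs g s j : gate_on qs g -> j \notin qs -> ceval g s j = s j.
Proof.
rewrite /gate_on => /andP[_ /allP h] hj.
have nj i : i \in cqubits g -> (j == i) = false.
  by move=> hi; apply/eqP => e; move: (h _ hi); rewrite -e inE (negPf hj).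
by case: g nj {h} => [t|a t|a b t] /= nj; rewrite updE nj // !inE eqxx ?orbT.
Qed.

Lemma evals_out qs cs s j : all (gate_on qs) cs -> j \notin qs -> evals cs s j = s j.
Proof.
elim: cs s => //= g cs IH s /andP[hg hcs] hj.
by rewrite IH // (ceval_out _ hg).
Qed.

(** Lets a result written into [t] pass through the uncomputation of all other qubits. *)
Lemma evals_upd qs cs s t b : all (gate_on qs) cs -> t \notin qs ->
  evals cs (upd s t b) = upd (evals cs s) t b.
Proof.
elim: cs s => //= g cs IH s /andP[hg hcs] ht; rewrite -IH //; congr evals.
move: hg; rewrite /gate_on => /andP[_ /allP h].
have nt i : i \in cqubits g -> (i == t) = false.
  by move=> hi; apply/eqP => e; move: (h _ hi); rewrite e inE (negPf ht).
apply/funext => j; case: g nt {h} => [q|a q|a c q] /= nt; rewrite !updE.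
- rewrite (nt q) ?inE //; case: (altP (j =P q)) => [->|] //.
  by rewrite nt ?inE.
- rewrite (nt q) ?(nt a) ?inE ?eqxx ?orbT //.
  case: (altP (j =P q)) => [->|] //; by rewrite nt ?inE ?eqxx ?orbT.
rewrite (nt q) ?(nt a) ?(nt c) ?inE ?eqxx ?orbT //.
case: (altP (j =P q)) => [->|] //; by rewrite nt ?inE ?eqxx ?orbT.
Qed.

Ltac neqs := rewrite ?eqxx; repeat match goal with
  | H : is_true (?x != ?y) |- context [?x == ?y] => rewrite (negPf H)
  | H : is_true (?x != ?y) |- context [?y == ?x] => rewrite (eq_sym y x) (negPf H)
  end.
Ltac unorm := repeat (progress rewrite ?cons_uniq ?cat_uniq ?has_cat ?mem_cat ?in_cons
  ?in_nil ?negb_or ?orbF ?andbT ?rev_cons ?has_nil /=).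
Ltac usplit := repeat match goal with
  | H : is_true (_ && _) |- _ => case/andP: H => ? ? end.
Ltac usolve :=
  repeat match goal with
  | H : is_true (uniq (_ :: _)) |- _ => move: H; unorm; move=> H
  | H : is_true (uniq (_ ++ _)) |- _ => move: H; unorm; move=> H end;
  usplit; unorm;
  repeat (apply/andP; split);
  try done; try assumption; try (by rewrite eq_sym; assumption);
  try (by rewrite has_sym; unorm; repeat (apply/andP; split);
       first [assumption | rewrite eq_sym; assumption | rewrite has_sym; assumption]).

(** The majority of the three bits, that is the carry, replaces [a], which then serves as the carry
    wire of the next position. *)
Definition maj (c b a : nat) : seq cgate := [:: TC a b; TC a c; TT c b a].

(** Adds [xs] and the carry-in [c] to [ys] and drops the last carry. The closing gates restore [a]
    and [c] while they write the sum bit into [b]. *)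
Fixpoint adder (c : nat) (xs ys : seq nat) : seq cgate :=
  match xs, ys with
  | a :: xs', b :: ys' =>
      maj c b a ++ adder a xs' ys' ++ [:: TT c b a; TC a c; TC c b]
  | _, _ => [::]
  end.

(** One step of a full adder; the carry is the majority in the form that [maj] computes. *)
Lemma sum_bits (a b c : bool) (A B : nat) :
  (a + 2 * A) + (b + 2 * B) + c =
  (a (+) b (+) c) + 2 * (A + B + (((a (+) c) && (a (+) b)) (+) a)).
Proof. by case: a; case: b; case: c => /=; lia. Qed.

Lemma adder_on c xs ys : uniq (c :: xs ++ ys) ->
  all (gate_on (c :: xs ++ ys)) (adder c xs ys).
Proof.
elim: xs c ys => [|a xs IH] c [|b ys] // u.
have u' : uniq (a :: xs ++ ys).
  by usolve.
have uabc : uniq [:: a; b; c].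
  by usolve.
rewrite /= !all_cat /= !/(gate_on _ (TC _ _)) !/(gate_on _ (TT _ _ _)) /=.
move: uabc; rewrite /= !inE !mem_cat !inE !eqxx !orbT /= !negb_or !andbT.
case/andP => /andP[h1 h2] h3.
rewrite (eq_sym c b) (eq_sym c a) (eq_sym b a) h1 h2 h3 /= andbT.
apply: gate_on_sub (IH _ _ u') => j; rewrite !inE !mem_cat inE.
by case/or3P => -> //; rewrite ?orbT.
Qed.

(** The recursive call changes only the remaining [ys], so the closing gates find in [a], [b] and
    [c] what [maj] put there. *)
Lemma adderE c xs ys s : uniq (c :: xs ++ ys) -> size xs = size ys ->
  evals (adder c xs ys) s = setb s ys (bval s xs + bval s ys + s c).
Proof.
elim: xs c ys s => [|a xs IH] c [|b ys] s u esz //; try by case: esz.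
move: esz => [esz].
rewrite (_ : adder c (a :: xs) (b :: ys) =
  maj c b a ++ adder a xs ys ++ [:: TT c b a; TC a c; TC c b]) // !evals_cat.
have u' : uniq (a :: xs ++ ys).
  by usolve.
have [nca ncb nab cxs cys] :
  [/\ c != a, c != b, a != b, c \notin xs & c \notin ys].
  by split; usolve.
have [axs ays bxs bys] : [/\ a \notin xs, a \notin ys, b \notin xs & b \notin ys].
  by split; usolve.
rewrite IH //; set s1 := evals (maj c b a) s.
have ea : s1 a = ((s a (+) s c) && (s a (+) s b)) (+) s a.
  by rewrite /s1 /= !updE; neqs.
have eb : s1 b = s a (+) s b.
  by rewrite /s1 /= !updE; neqs.
have ec : s1 c = s a (+) s c.
  by rewrite /s1 /= !updE; neqs.
have es j : j != a -> j != b -> j != c -> s1 j = s j.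
  by move=> /negPf h1 /negPf h2 /negPf h3; rewrite /s1 /= !updE h1 h2 h3.
have notin (j : nat) (zs : seq nat) (x : nat) : j \in zs -> x \notin zs -> j != x.
  by move=> hj; apply: contraNneq => <-.
have -> : bval s1 xs = bval s xs.
  by apply: bval_ext => j hj; apply: es; apply: (notin _ _ _ hj).
have -> : bval s1 ys = bval s ys.
  by apply: bval_ext => j hj; apply: es; apply: (notin _ _ _ hj).
rewrite [bval s (a :: xs)]/= [bval s (b :: ys)]/= sum_bits setb_cons.
rewrite half_bit odd_bit -ea; set v := (X in setb s1 ys X).
have eqa : setb s1 ys v a = s1 a by apply: setb_out.
have eqb : setb s1 ys v b = s1 b by apply: setb_out.
have eqc : setb s1 ys v c = s1 c by apply: setb_out.
apply/funext => j /=; rewrite !updE; neqs.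
rewrite eqa eqb eqc ea eb ec.
case: (altP (j =P b)) => [_|njb].
  by case: (s a); case: (s b); case: (s c).
case: (altP (j =P c)) => [->|njc].
  by rewrite setb_out //; case: (s a); case: (s b); case: (s c).
case: (altP (j =P a)) => [->|nja].
  by rewrite setb_out //; case: (s a); case: (s b); case: (s c).
by rewrite /setb; case: ifP => _; rewrite ?es // /v ea.
Qed.

(** Runs up the carry chain, adds the last carry to [t] and runs back down, so that no sum is
    written. *)
Fixpoint carry (c : nat) (xs ys : seq nat) (t : nat) : seq cgate :=
  match xs, ys with
  | a :: xs', b :: ys' => maj c b a ++ carry a xs' ys' t ++ rev (maj c b a)
  | _, _ => [:: TC c t]
  end.

Lemma maj_on c b a : uniq [:: c; b; a] -> all (gate_on [:: c; b; a]) (maj c b a).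
Proof.
rewrite /= /gate_on /= !inE !eqxx !orbT !andbT /= negb_or => /andP[/andP[h1 h2] h3].
by rewrite (eq_sym a b) (eq_sym a c) h1 h2 h3.
Qed.

Lemma carry_on c xs ys t : uniq (t :: c :: xs ++ ys) -> size xs = size ys ->
  all (gate_on (t :: c :: xs ++ ys)) (carry c xs ys t).
Proof.
elim: xs c ys => [|a xs IH] c [|b ys] u esz; try by case: esz.
  by move: u; rewrite /= /gate_on /= !inE !eqxx ?orbT eq_sym => /andP[->].
move: esz => [esz].
have u' : uniq (t :: a :: xs ++ ys).
  by usolve.
have um : uniq [:: c; b; a].
  by usolve.
rewrite /= -/(maj c b a) -/(rev (maj c b a)).
have hm : all (gate_on (t :: c :: (a :: xs) ++ b :: ys)) (maj c b a).
  apply: gate_on_sub (maj_on um) => j; rewrite !inE mem_cat !inE.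
  by case/or3P => ->; rewrite ?orbT.
change (all (gate_on (t :: c :: (a :: xs) ++ b :: ys))
  (maj c b a ++ carry a xs ys t ++ rev (maj c b a))).
rewrite !all_cat hm all_rev hm andbT /=.
apply: gate_on_sub (IH _ _ u' esz) => j; rewrite !inE !mem_cat inE.
by case/or4P => ->; rewrite ?orbT.
Qed.

Lemma carryE c xs ys t s : uniq (t :: c :: xs ++ ys) -> size xs = size ys ->
  evals (carry c xs ys t) s =
    upd s t ((2 ^ size xs <= bval s xs + bval s ys + s c) (+) s t).
Proof.
elim: xs c ys s => [|a xs IH] c [|b ys] s u esz; try by case: esz.
  by rewrite /= expn0 !add0n lt0b.
move: esz => [esz].
have u' : uniq (t :: a :: xs ++ ys).
  by usolve.
have um : uniq [:: c; b; a].
  by usolve.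
have [tc ta tb] : [/\ t != c, t != a & t != b].
  by split; usolve.
have [nca ncb nab cxs cys] :
  [/\ c != a, c != b, a != b, c \notin xs & c \notin ys].
  by split; usolve.
have [axs ays bxs bys] : [/\ a \notin xs, a \notin ys, b \notin xs & b \notin ys].
  by split; usolve.
change (evals (maj c b a ++ carry a xs ys t ++ rev (maj c b a)) s = 
    upd s t ((2 ^ size (a :: xs) <= bval s (a :: xs) + bval s (b :: ys) + s c) (+) s t)).
rewrite !evals_cat IH // (@evals_upd [:: c; b; a]); last 2 first.
- by rewrite all_rev maj_on.
- by rewrite !inE !negb_or tc tb ta.
rewrite (evals_revK _ (maj_on um)); set s1 := evals (maj c b a) s.
have ea : s1 a = ((s a (+) s c) && (s a (+) s b)) (+) s a.
  by rewrite /s1 /= !updE; neqs.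
have es j : j != a -> j != b -> j != c -> s1 j = s j.
  by move=> /negPf h1 /negPf h2 /negPf h3; rewrite /s1 /= !updE h1 h2 h3.
have notin (j : nat) (zs : seq nat) (x : nat) : j \in zs -> x \notin zs -> j != x.
  by move=> hj; apply: contraNneq => <-.
have -> : bval s1 xs = bval s xs.
  by apply: bval_ext => j hj; apply: es; apply: (notin _ _ _ hj).
have -> : bval s1 ys = bval s ys.
  by apply: bval_ext => j hj; apply: es; apply: (notin _ _ _ hj).
rewrite (es t) // [bval s (a :: xs)]/= [bval s (b :: ys)]/= sum_bits -ea.
rewrite [size _]/= expnS; congr (upd s t (_ (+) s t)).
rewrite -/(size xs).
move: (2 ^ size xs) (bval s xs) (bval s ys) (nat_of_bool (s1 a)) => k x y z.
by case: (_ (+) _ (+) _); clear; lia.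
Qed.

(** * Increments and conjunctions with borrowed qubits *)

Definition nots (qs : seq nat) : seq cgate := [seq TX q | q <- qs].

Lemma gate_on_TX (qs : seq nat) t : t \in qs -> gate_on qs (TX t).
Proof. by rewrite /gate_on /= => ->. Qed.

Lemma nots_on qs : all (gate_on qs) (nots qs).
Proof. by rewrite all_map; apply/allP => q hq /=; rewrite /gate_on /= hq. Qed.

Lemma notsE qs s j : uniq qs -> evals (nots qs) s j = (j \in qs) (+) s j.
Proof.
elim: qs s => //= q qs IH s /andP[nq uq]; rewrite IH // updE inE.
by case: (altP (j =P q)) => [->|_] //=; rewrite (negPf nq).
Qed.

Lemma bval_nots qs s : uniq qs ->
  (bval (evals (nots qs) s) qs + bval s qs).+1 = 2 ^ size qs.
Proof.
move=> uq; have -> : bval (evals (nots qs) s) qs = bval (fun j => ~~ s j) qs.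
  by apply: bval_ext => j hj; rewrite notsE // hj addTb.
by elim: qs {uq} => //= q qs IH; rewrite expnS -IH; case: (s q) => /=; lia.
Qed.

Definition cinc (e c : nat) (gs xs : seq nat) : seq cgate :=
  adder e gs xs ++ nots gs ++ [:: TX c] ++ adder c gs xs ++ [:: TX c] ++ nots gs.

Lemma uniq_sub (A Z Y : seq nat) k : uniq (A ++ Z ++ Y) -> uniq (A ++ take k Z ++ Y).
Proof.
apply: subseq_uniq; apply: cat_subseq => //; apply: cat_subseq => //.
exact: take_subseq.
Qed.

Lemma cinc_on e c gs xs : uniq (e :: c :: gs ++ xs) ->
  all (gate_on (e :: c :: gs ++ xs)) (cinc e c gs xs).
Proof.
move=> u.
have u1 : uniq (e :: gs ++ xs) by usolve.
have u2 : uniq (c :: gs ++ xs) by usolve.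
have h1 : all (gate_on (e :: c :: gs ++ xs)) (adder e gs xs).
  by apply: gate_on_sub (adder_on u1) => j; unorm => /or3P[] ->; rewrite ?orbT.
have h2 : all (gate_on (e :: c :: gs ++ xs)) (adder c gs xs).
  by apply: gate_on_sub (adder_on u2) => j; unorm => /or3P[] ->; rewrite ?orbT.
have h3 : all (gate_on (e :: c :: gs ++ xs)) (nots gs).
  by apply: gate_on_sub (nots_on gs) => j; unorm => ->; rewrite ?orbT.
have h4 : gate_on (e :: c :: gs ++ xs) (TX c).
  by apply: gate_on_TX; rewrite inE mem_head orbT.
by rewrite /cinc !all_cat h1 h2 h3 !all_seq1 h4.
Qed.

(* Addition of [gs] and then of its complement [2 ^ k - 1 - gs] plus one, so
   that the value of the borrowed qubits [gs] is irrelevant. *)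
Lemma cincE e c gs xs s : uniq (e :: c :: gs ++ xs) -> size gs = size xs ->
  s c = false -> evals (cinc e c gs xs) s = setb s xs (bval s xs + s e).
Proof.
move=> u esz sc.
have u1 : uniq (e :: gs ++ xs) by usolve.
have u2 : uniq (c :: gs ++ xs) by usolve.
have ugs : uniq gs by usolve.
have uxs : uniq xs by usolve.
have cxs : c \notin xs by usolve.
have cgs : c \notin gs by usolve.
have dsj : ~~ has (mem xs) gs by usolve.
have dsj' : ~~ has (mem gs) xs by usolve.
rewrite /cinc !evals_cat adderE // adderE //.
set s1 := setb s xs _; set s2 := evals (nots gs) s1; set s3 := evals [:: TX c] s2.
have e2 j : s2 j = (j \in gs) (+) s1 j by rewrite /s2 notsE.
have e3 j : s3 j = (j == c) (+) s2 j.
  by rewrite /s3 /= updE; case: eqP => [->|].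
have b1 : bval s1 gs = bval s gs by apply: bval_setb_disj.
have b3 : bval s3 gs = bval s2 gs by apply: bval_upd.
have x3 : bval s3 xs = (bval s gs + bval s xs + s e) %% 2 ^ size xs.
  rewrite bval_upd // -(bval_setb s) //; apply: bval_ext => j hj.
  rewrite e2; case: (boolP (j \in gs)) => // hg.
  by case/hasP: dsj; exists j.
have c3 : s3 c = true by rewrite e3 e2 (negPf cgs) eqxx /s1 setb_out // sc.
rewrite x3 b3 c3.
have n2 : (bval s2 gs + bval s gs).+1 = 2 ^ size xs by rewrite -b1 bval_nots // esz.
rewrite (@setb_eqm _ _ _ (bval s xs + s e)); last first.
  rewrite -addnA addnCA modnDml -[RHS]modnDl -n2; congr (_ %% _).
  move: (bval s2 gs) (bval s gs) (bval s xs) (nat_of_bool (s e)); clear; lia.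
apply/funext => j; rewrite notsE //=; rewrite updE /=.
rewrite (@setb_out s3) // c3 /=.
case: (altP (j =P c)) => [->|njc].
  by rewrite (negPf cgs) setb_out.
rewrite /setb; case: (boolP (j \in xs)) => hx.
  case: (boolP (j \in gs)) => // hg.
  by case/hasP: dsj; exists j.
by rewrite e3 (negPf njc) e2 /= addbA addbb /s1 setb_out.
Qed.

Lemma bval_all s qs : ((bval s qs).+1 == 2 ^ size qs) = all s qs.
Proof.
elim: qs => //= q qs <-; rewrite expnS; move: (2 ^ size qs) => k.
by case: (s q) => /=; lia.
Qed.

Lemma carry_out s xs e : (bval s xs + s e) %/ 2 ^ size xs = s e && all s xs.
Proof.
have := bval_lt s xs; rewrite -bval_all.
case: (s e) => /=; rewrite ?addn0; last by move=> h; rewrite divn_small.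
rewrite addn1 leq_eqVlt; case: eqP => [-> _|_ /= h].
  by rewrite divnn expn_gt0.
by rewrite divn_small.
Qed.

Lemma setb_carry s xs t e : t \notin xs ->
  setb s (xs ++ [:: t]) (bval s (xs ++ [:: t]) + s e) =
  setb (upd s t ((s e && all s xs) (+) s t)) xs (bval s xs + s e).
Proof.
move=> ht; rewrite setb_cat bval_cat /= muln0 addn0.
have -> : bval s xs + 2 ^ size xs * s t + s e
  = s t * 2 ^ size xs + (bval s xs + s e) by ring.
rewrite divnMDl ?expn_gt0 // carry_out.
rewrite (@setb_eqm _ _ _ (bval s xs + s e)) ?modnMDl //.
rewrite setb_cons setb_nil oddD !oddb; congr (setb (upd _ _ _) _ _).
by rewrite addbC.
Qed.

(** The carry of [setb_carry] used as a multiply controlled NOT on [t]. The second register is one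
    qubit shorter, hence borrows one qubit less. *)
Definition dand (e c : nat) (gs xs : seq nat) (t : nat) : seq cgate :=
  cinc e c gs (xs ++ [:: t]) ++ rev (cinc e c (behead gs) xs).

Lemma dand_uniq (e c : nat) gs xs t : uniq (e :: c :: gs ++ xs ++ [:: t]) ->
  uniq (e :: c :: behead gs ++ xs).
Proof. by case: gs => [|g gs] u; usolve. Qed.

Lemma dand_on e c gs xs t : uniq (e :: c :: gs ++ xs ++ [:: t]) ->
  all (gate_on (e :: c :: gs ++ xs ++ [:: t])) (dand e c gs xs t).
Proof.
move=> u; rewrite /dand all_cat cinc_on //= all_rev.
apply: gate_on_sub (cinc_on (dand_uniq u)) => j; unorm.
case/or4P => // hj; rewrite ?hj ?orbT //.
by rewrite (mem_behead hj) ?orbT.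
Qed.

Lemma dandE e c gs xs t s : uniq (e :: c :: gs ++ xs ++ [:: t]) ->
  size gs = (size xs).+1 -> s c = false ->
  evals (dand e c gs xs t) s = upd s t ((s e && all s xs) (+) s t).
Proof.
move=> u esz sc; rewrite evals_cat cincE //; last by rewrite size_cat addn1.
apply: evals_rev (cinc_on (dand_uniq u)) _; rewrite (cincE (dand_uniq u)).
- have ht : t \notin xs by usolve.
  rewrite setb_carry // bval_upd // updE.
  suff -> : (e == t) = false by [].
  by apply: negbTE; usolve.
- by rewrite size_behead esz.
rewrite updE; suff -> : (c == t) = false by [].
by apply: negbTE; usolve.
Qed.

(* Increment of [H] controlled by [e] with four spare qubits only: each half of
   [H] (with [z]) is borrowed while the other half is incremented; [c] and [w]
   are clean. *)
Definition binc (e c w z : nat) (H : seq nat) : seq cgate :=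
  let H1 := take (size H)./2 H in
  let H2 := drop (size H)./2 H in
  let d := dand e c (take (size H1).+1 (H2 ++ [:: z])) H1 w in
  d ++ cinc w c (take (size H2) (H1 ++ [:: z])) H2 ++ rev d
    ++ cinc e c (take (size H1) H2) H1.

Section Binc.
Variables (e c w z : nat) (H : seq nat).
Let H1 := take (size H)./2 H.
Let H2 := drop (size H)./2 H.
Let g1 := take (size H1).+1 (H2 ++ [:: z]).
Let g2 := take (size H2) (H1 ++ [:: z]).
Let g3 := take (size H1) H2.

Let eH : H = H1 ++ H2.
Proof. by rewrite cat_take_drop. Qed.

Let s1 : size H1 = (size H)./2.
Proof. by rewrite size_take; case: ltnP => //; lia. Qed.

Let s2 : size H2 = size H - (size H)./2.
Proof. by rewrite size_drop. Qed.

Hypothesis u : uniq (e :: c :: w :: z :: H).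

Let u' : uniq (e :: c :: w :: z :: H1 ++ H2).
Proof. by rewrite -eH. Qed.

Let u1 : uniq ([:: e; c] ++ g1 ++ H1 ++ [:: w]).
Proof. by apply: uniq_sub; move: u' => uu; usolve. Qed.

Let u2 : uniq ([:: w; c] ++ g2 ++ H2).
Proof. by apply: uniq_sub; move: u' => uu; usolve. Qed.

Let u3 : uniq ([:: e; c] ++ g3 ++ H1).
Proof. by apply: uniq_sub; move: u' => uu; usolve. Qed.

Let bE : binc e c w z H = dand e c g1 H1 w ++ cinc w c g2 H2
  ++ rev (dand e c g1 H1 w) ++ cinc e c g3 H1.
Proof. by []. Qed.

Lemma binc_on : all (gate_on (e :: c :: w :: z :: H)) (binc e c w z H).
Proof.
have h1 : all (gate_on (e :: c :: w :: z :: H)) (dand e c g1 H1 w).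
  apply: gate_on_sub (dand_on u1) => j; rewrite eH; unorm.
  case/or4P => [->|->|hj|/orP[->|->]]; rewrite ?orbT //.
  by move: (mem_take hj); unorm => /orP[->|->]; rewrite ?orbT.
rewrite bE all_cat h1 all_cat andTb andbC all_cat all_rev h1 andTb; apply/andP; split; last first.
  apply: gate_on_sub (cinc_on u2) => j; rewrite eH; unorm.
  case/or4P => [->|->|hj|->]; rewrite ?orbT //.
  by move: (mem_take hj); unorm => /orP[->|->]; rewrite ?orbT.
apply: gate_on_sub (cinc_on u3) => j; rewrite eH; unorm.
case/or4P => [->|->|hj|->]; rewrite ?orbT //.
by rewrite (mem_take hj) ?orbT.
Qed.

Lemma bincE s : s c = false -> s w = false ->
  evals (binc e c w z H) s = setb s H (bval s H + s e).
Proof.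
move=> sc sw; have uu := u'.
(* The halves differ by at most one qubit, and [w] lengthens the register of the first increment by
   one: [z] makes up for the missing qubit. *)
have z1 : size g1 = (size H1).+1.
  by rewrite size_takel // size_cat /= s1 s2; lia.
have z2 : size g2 = size H2.
  by rewrite size_takel // size_cat /= s1 s2; lia.
have z3 : size g3 = size H1.
  by rewrite size_takel // s1 s2; lia.
have nwc : w != c by usolve.
have nwe : w != e by usolve.
have nec : e != c by usolve.
have wH1 : w \notin H1 by usolve.
have wH2 : w \notin H2 by usolve.
have eH2 : e \notin H2 by usolve.
have cH2 : c \notin H2 by usolve.
have dsj : ~~ has (mem H2) H1 by usolve.
have evals_cat4 p q r t0 v : evals (p ++ q ++ r ++ t0) v =
    evals t0 (evals r (evals q (evals p v))) by rewrite !evals_cat.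
rewrite bE evals_cat4.
(* [b] is the carry from the lower half [H1] into the upper half [H2]. *)
rewrite dandE // sw addbF; set b := s e && all s H1.
rewrite (cincE u2) //; last by rewrite updE; neqs.
rewrite bval_upd // updE eqxx.
(* Reversing [d] clears [w] although the borrowed [H2] has changed meanwhile: [b] depends on [e] and
   [H1] only. *)
rewrite (_ : evals (rev _) _ = setb s H2 (bval s H2 + b)); last first.
  apply: evals_rev (dand_on u1) _; rewrite dandE //; last by rewrite setb_out.
  apply/funext => j; rewrite updE (@setb_out s H2 _ e) // (@setb_out s H2 _ w) // sw addbF.
  have -> : all (setb s H2 (bval s H2 + b)) H1 = all s H1.
    by apply: eq_in_all => i hi; apply: setb_out; apply: contraNN dsj => hi2;
       apply/hasP; exists i.
  by rewrite -/b /setb updE; case: (altP (j =P w)) => [->|] //; rewrite (negPf wH2).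
rewrite (cincE u3) //; last by rewrite setb_out.
rewrite setb_out // bval_setb_disj // eH bval_cat setb_cat.
have k0 : 0 < 2 ^ size H1 by rewrite expn_gt0.
have -> : bval s H1 + 2 ^ size H1 * bval s H2 + s e
  = bval s H2 * 2 ^ size H1 + (bval s H1 + s e) by ring.
rewrite divnMDl // carry_out -/b.
by apply: setb_eqm; rewrite modnMDl.
Qed.

End Binc.

(* Incrementing [T] extended by [f] and then decrementing [T] leaves the carry
   in [f]. *)
Definition flag (e c w z : nat) (T : seq nat) (f : nat) : seq cgate :=
  binc e c w z (T ++ [:: f]) ++ rev (binc e c w z T).

Lemma flag_on e c w z T f : uniq (e :: c :: w :: z :: T ++ [:: f]) ->
  all (gate_on (e :: c :: w :: z :: T ++ [:: f])) (flag e c w z T f).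
Proof.
move=> u; have u' : uniq (e :: c :: w :: z :: T) by usolve.
rewrite /flag all_cat binc_on //= all_rev.
apply: gate_on_sub (binc_on u') => j; unorm.
by case/or4P => [->|->|->|/orP[->|->]]; rewrite ?orbT.
Qed.

Lemma flagE e c w z T f s : uniq (e :: c :: w :: z :: T ++ [:: f]) ->
  s c = false -> s w = false ->
  evals (flag e c w z T f) s = upd s f ((s e && all s T) (+) s f).
Proof.
move=> u sc sw; have u' : uniq (e :: c :: w :: z :: T) by usolve.
have nce : c != f by usolve.
have nwf : w != f by usolve.
have nef : e != f by usolve.
have fT : f \notin T by usolve.
rewrite evals_cat bincE //; apply: evals_rev (binc_on u') _.
rewrite bincE ?updE; neqs; rewrite ?sc ?sw //.
by rewrite setb_carry // bval_upd.
Qed.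

(** * Comparison with a constant *)

Fixpoint load (f : nat) (gs : seq nat) (t : nat) : seq cgate :=
  if gs is g :: gs' then nseq (odd t) (TC f g) ++ load f gs' t./2 else [::].

Lemma load_on f gs t : uniq (f :: gs) -> all (gate_on (f :: gs)) (load f gs t).
Proof.
elim: gs t => // g gs IH t u; have u' : uniq (f :: gs) by usolve.
have nfg : f != g by usolve.
rewrite [load _ _ _]/= all_cat all_nseq; apply/andP; split.
  by case: odd => //=; rewrite /gate_on /= !inE nfg !eqxx !orbT.
by apply: gate_on_sub (IH _ u') => j; rewrite !inE => /orP[->|->]; rewrite ?orbT.
Qed.

Lemma loadE f gs t s j : uniq (f :: gs) ->
  evals (load f gs t) s j = [&& j \in gs, s f & qbit t (index j gs)] (+) s j.
Proof.
elim: gs t s => [|g gs IH] t s u; first by [].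
have u' : uniq (f :: gs) by usolve.
have nfg : f != g by usolve.
have ng : g \notin gs by usolve.
rewrite [load _ _ _]/= evals_cat IH // inE.
have -> : evals (nseq (odd t) (TC f g)) s = upd s g ((s f && odd t) (+) s g).
  by case: (odd t) => /=; rewrite ?andbT // andbF upd_id.
rewrite !updE (negPf nfg) [index _ (_ :: _)]/=.
case: (altP (j =P g)) => [->|njg] /=.
  by rewrite eqxx (negPf ng) qbit0.
by rewrite eq_sym (negPf njg) qbitS.
Qed.

(* The constant is loaded under the control of [f], so that the carry is
   already conditioned on [f]. *)
Definition cmp (f c : nat) (gs xs : seq nat) (t r : nat) : seq cgate :=
  load f gs t ++ carry c gs xs r ++ rev (load f gs t).

Section Cmp.
Variables (f c r t : nat) (gs xs : seq nat).
Hypothesis u : uniq (r :: f :: c :: gs ++ xs).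
Hypothesis esz : size gs = size xs.

Let u1 : uniq (f :: gs).
Proof. by move: u => uu; usolve. Qed.

Let u2 : uniq (r :: c :: gs ++ xs).
Proof. by move: u => uu; usolve. Qed.

Lemma cmp_on : all (gate_on (r :: f :: c :: gs ++ xs)) (cmp f c gs xs t r).
Proof.
have h : all (gate_on (r :: f :: c :: gs ++ xs)) (load f gs t).
  by apply: gate_on_sub (load_on _ u1) => j; unorm => /orP[]->; rewrite ?orbT.
rewrite /cmp all_cat h all_cat all_rev h andbT andTb.
by apply: gate_on_sub (carry_on u2 esz) => j; unorm => /or4P[]->; rewrite ?orbT.
Qed.

Lemma cmpE s : t < 2 ^ size gs -> s c = false -> {in gs, s =1 xpred0} ->
  evals (cmp f c gs xs t r) s =
    upd s r ((s f && (2 ^ size gs <= t + bval s xs)) (+) s r).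
Proof.
move=> ltt sc sgs; move: u => uu.
have rf : r != f by usolve.
have rgs : r \notin gs by usolve.
have cgs : c \notin gs by usolve.
have dsj : ~~ has (mem gs) xs by usolve.
rewrite /cmp evals_cat evals_cat carryE // (@evals_upd (f :: gs)); last 2 first.
- by rewrite all_rev load_on.
- by rewrite inE negb_or rf.
rewrite (evals_revK _ (load_on t u1)).
rewrite !loadE // (negPf rgs) (negPf cgs) sc !addFb addn0.
have -> : bval (evals (load f gs t) s) xs = bval s xs.
  apply: bval_ext => j hj; rewrite loadE //.
  case: (boolP (j \in gs)) => // hg; by case/hasP: dsj; exists j.
have -> : bval (evals (load f gs t) s) gs = s f * t.
  apply: (@qbit_inj _ _ (size gs)); rewrite ?bval_lt //.
    by case: (s f); rewrite ?mul1n ?mul0n ?expn_gt0.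
  move=> j ltj; rewrite bval_qbit // loadE // mem_nth // index_uniq //; last by usolve.
  rewrite (sgs (nth 0 gs j)) ?mem_nth //= addbF; case: (s f); rewrite ?mul1n ?mul0n ?qbit_zero //.
congr (upd s r (_ (+) s r)); case: (s f); rewrite ?mul1n //.
(* With [f] clear nothing is loaded, and [xs] alone cannot overflow. *)
by rewrite mul0n add0n leqNgt esz bval_lt.
Qed.

End Cmp.

(** * Controlled rotation of a register *)

Definition cswap (f a b : nat) : seq cgate := [:: TC b a; TT f a b; TC b a].

Lemma cswapE f a b s : uniq [:: f; a; b] ->
  evals (cswap f a b) s = if s f then upd (upd s a (s b)) b (s a) else s.
Proof.
move=> u; have fa : f != a by usolve.
have fb : f != b by usolve.
have ab : a != b by usolve.
apply/funext => j; rewrite /= !updE; neqs.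
case: (altP (j =P a)) => [->|nja]; neqs.
  by case: (s f); rewrite ?updE; neqs; rewrite /=; case: (s a); case: (s b).
case: (altP (j =P b)) => [->|njb].
  by case: (s f); rewrite ?updE; neqs; rewrite /=; case: (s a); case: (s b).
by case: (s f); rewrite ?updE; neqs.
Qed.

(** A chain of neighbouring swaps carries the bit of [a] to the top and moves every other bit one
    place down. *)
Fixpoint crot (f a : nat) (qs : seq nat) : seq cgate :=
  if qs is b :: qs' then cswap f a b ++ crot f b qs' else [::].

Lemma crot_on f a qs : uniq (f :: a :: qs) ->
  all (gate_on (f :: a :: qs)) (crot f a qs).
Proof.
elim: qs a => // b qs IH a u; have u' : uniq (f :: b :: qs) by usolve.
have fa : f != a by usolve.
have fb : f != b by usolve.
have ba : b != a by usolve.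
rewrite /gate_on /= !inE !eqxx !orbT ?andbT; neqs; rewrite /=.
by apply: gate_on_sub (IH _ u') => j; rewrite !inE => /or3P[]->; rewrite ?orbT.
Qed.

Lemma crotE f a qs s : uniq (f :: a :: qs) ->
  evals (crot f a qs) s =
    if s f then setb s (a :: qs) (bval s qs + 2 ^ size qs * s a) else s.
Proof.
elim: qs a s => [|b qs IH] a s u.
  by case: ifP => //= _; rewrite mul1n setb_cons setb_nil oddb upd_id.
have u' : uniq (f :: b :: qs) by usolve.
have u3 : uniq [:: f; a; b] by usolve.
have fa : f != a by usolve.
have fb : f != b by usolve.
have ba : b != a by usolve.
have aqs : a \notin qs by usolve.
have bqs : b \notin qs by usolve.
rewrite [crot _ _ _]/= -[_ :: _ :: _ :: _]/(cswap f a b ++ crot f b qs).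
rewrite evals_cat cswapE // IH //.
case sf: (s f); last by rewrite sf.
rewrite (_ : upd _ _ _ f = true); last by rewrite !updE; neqs.
rewrite updE eqxx.
rewrite !bval_upd // [size (_ :: _)]/= [bval s (_ :: _)]/=.
have -> : s b + 2 * bval s qs + 2 ^ (size qs).+1 * s a
  = s b + 2 * (bval s qs + 2 ^ size qs * s a) by rewrite expnS; ring.
rewrite (setb_cons s a) half_bit odd_bit.
apply/funext => j; rewrite updE /setb inE !updE.
case: (altP (j =P b)) => [->|njb] /=; first by neqs.
by case: (altP (j =P a)) => [->|nja]; rewrite ?(negPf aqs).
Qed.

(** * Gate counts of the arithmetic circuits *)

Lemma size_adder c xs ys : size (adder c xs ys) <= 6 * size xs.
Proof.
by elim: xs c ys => [|a xs IH] c [|b ys] //=; rewrite size_cat /=; have := IH a ys; lia.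
Qed.

Lemma size_carry c xs ys t : size (carry c xs ys t) <= 6 * size xs + 1.
Proof.
elim: xs c ys => [|a xs IH] c [|b ys] //=; have := IH a ys; rewrite size_cat /=; lia.
Qed.

Lemma size_load f gs t : size (load f gs t) <= size gs.
Proof.
elim: gs t => //= g gs IH t; rewrite size_cat size_nseq; have := IH t./2.
by case: odd => /=; lia.
Qed.

Lemma size_cmp f c gs xs t r : size (cmp f c gs xs t r) <= 8 * size gs + 1.
Proof.
rewrite !size_cat size_rev; have := size_load f gs t; have := size_carry c gs xs r.
lia.
Qed.

Lemma size_crot f a qs : size (crot f a qs) = 3 * size qs.
Proof. by elim: qs a => //= b qs IH a; rewrite IH; lia. Qed.

Lemma size_cinc e c gs xs : size (cinc e c gs xs) <= 14 * size gs + 2.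
Proof.
rewrite !size_cat /= size_map; have := size_adder e gs xs; have := size_adder c gs xs.
lia.
Qed.

Lemma size_dand e c gs xs t : size (dand e c gs xs t) <= 28 * size gs + 4.
Proof.
rewrite size_cat size_rev; have := size_cinc e c gs (xs ++ [:: t]).
have := size_cinc e c (behead gs) xs; rewrite size_behead; lia.
Qed.

Lemma size_binc e c w z H : size (binc e c w z H) <= 84 * size H + 68.
Proof.
rewrite /binc; set H1 := take _ H; set H2 := drop _ H; cbv zeta.
rewrite size_cat 2!(size_cat (cinc _ _ _ _), size_cat (rev _)) size_rev.
set g1 := take _ (H2 ++ _); set g2 := take _ (H1 ++ _); set g3 := take _ H2.
have l1 : size g1 <= size H + 1.
  by rewrite size_take size_cat size_drop /=; case: ifP => //; rewrite ?size_take; lia.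
have l2 : size g2 <= size H by rewrite size_take size_drop; case: ifP; lia.
have l3 : size g3 <= size H by rewrite size_take size_drop; case: ifP; lia.
have := size_dand e c g1 H1 w; have := size_cinc w c g2 H2.
have := size_cinc e c g3 H1; lia.
Qed.

Lemma size_flag e c w z T f : size (flag e c w z T f) <= 168 * size T + 220.
Proof.
rewrite size_cat size_rev; have := size_binc e c w z (T ++ [:: f]).
by rewrite size_cat /=; have := size_binc e c w z T; lia.
Qed.

(** * From reversible circuits to matrices *)

Section Bridge.
Local Open Scope ring_scope.
Local Open Scope complex_scope.
Variable R : realType.
Local Notation C := (R[i]).
Variable N : nat.

Lemma idx_subproof (s : state) : (bval s (iota 0 N) < 2 ^ N)%N.
Proof. by rewrite -{2}(size_iota 0 N) bval_lt. Qed.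

Definition idx (s : state) : 'I_(2 ^ N) := Ordinal (idx_subproof s).

Lemma qbit_idx s q : (q < N)%N -> qbit (idx s) q = s q.
Proof. by move=> h; rewrite bval_qbit ?size_iota // nth_iota. Qed.

Lemma eq_idx (z : 'I_(2 ^ N)) s :
  (z == idx s) = [forall q : 'I_N, qbit z q == s q].
Proof.
apply/eqP/forallP => [-> q|h]; first by rewrite qbit_idx.
apply: val_inj; apply: (qbit_inj (ltn_ord z) (idx_subproof s)).
by move=> j hj; rewrite (eqP (h (Ordinal hj))) qbit_idx.
Qed.

Lemma idx_qbit (z : 'I_(2 ^ N)) : idx (qbit z) = z.
Proof. by apply/esym/eqP; rewrite eq_idx; apply/forallP => q. Qed.

(** Splits the comparison with an output basis state the way [embed] does: agreement outside the
    qubits of the gate, and a test on these qubits alone. *)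
Lemma eq_idx_split (z : 'I_(2 ^ N)) s s' qs :
  all (fun q => q < N)%N qs -> (forall j, j \notin qs -> s' j = s j) ->
  (z == idx s') =
    agree_outside N qs z (idx s) && all (fun q => qbit z q == s' q) qs.
Proof.
move=> hqs hs; rewrite eq_idx /agree_outside.
apply/forallP/andP => [h|[/forallP h1 /allP h2] q].
  split; last first.
    apply/allP => q hq; have lq : (q < N)%N by apply: (allP hqs).
    exact: (h (Ordinal lq)).
  apply/forallP => q; apply/implyP => nq.
  by rewrite (eqP (h q)) hs // qbit_idx.
case: (boolP (val q \in qs)) => hq; first exact: h2.
by have := h1 q; rewrite hq /= qbit_idx // hs.
Qed.

Lemma subidxE (qs : seq nat) (z : nat) : subidx qs z = bval (qbit z) qs.
Proof.
rewrite /subidx; elim: qs => [|q qs IH] /=; first by rewrite big_ord0.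
rewrite big_ord_recl /= muln1 -IH; congr (_ + _)%N.
rewrite big_distrr /=; apply: eq_bigr => i _.
by rewrite /bump /= add1n expnS; ring.
Qed.

Definition nmx (k : nat) (F : nat -> nat -> C) : 'M[C]_(2 ^ k) := \matrix_(r, c) F r c.

(** One term of the double sum in [embed] survives, the one at the local values of row and
    column. *)
Lemma embed_nmx k (qs : seq nat) F (z : 'I_(2 ^ N)) s :
  size qs = k -> all (fun q => q < N)%N qs ->
  embed N qs (nmx k F) z (idx s) =
    if agree_outside N qs z (idx s) then F (bval (qbit z) qs) (bval s qs) else 0.
Proof.
move=> sz hqs; rewrite mxE; case: ifP => // _.
have -> : bval s qs = subidx qs (idx s).
  rewrite subidxE; apply: bval_ext => q hq; rewrite qbit_idx //.
  exact: (allP hqs).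
rewrite -subidxE.
have l1 : (subidx qs z < 2 ^ k)%N by rewrite subidxE -sz bval_lt.
have l2 : (subidx qs (idx s) < 2 ^ k)%N by rewrite subidxE -sz bval_lt.
rewrite (bigD1 (Ordinal l1)) //= [X in _ + X]big1 ?addr0; last first.
  move=> a; rewrite -val_eqE /= => /negPf na; apply: big1 => b _.
  by rewrite na.
rewrite (bigD1 (Ordinal l2)) //= [X in _ + X]big1 ?addr0; last first.
  by move=> b; rewrite -val_eqE /= => /negPf nb; rewrite nb andbF.
by rewrite !eqxx /= mxE.
Qed.

Definition ket (s : state) : 'cV[C]_(2 ^ N) := \col_z (z == idx s)%:R.

Lemma mul_ket (A : 'M[C]_(2 ^ N)) s z : (A *m ket s) z 0 = A z (idx s).
Proof.
rewrite mxE (bigD1 (idx s)) //= big1 ?addr0 ?mxE ?eqxx ?mulr1 //.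
by move=> i /negPf ni; rewrite mxE ni mulr0.
Qed.

(** Row [r] has its one in column [tau r], as in [toffoli_mx]. Each [tau] used is an involution on
    its range, so this is also the action on basis states. *)
Definition permF (tau : nat -> nat) (r c : nat) : C := (c == tau r)%:R.

Lemma unitary_permF k tau : (forall i, (i < 2 ^ k)%N -> (tau i < 2 ^ k)%N) ->
  (forall i, (i < 2 ^ k)%N -> tau (tau i) = i) -> unitary_mx (nmx k (permF tau)).
Proof.
move=> tl tK; apply/matrixP => i j; rewrite !mxE.
have ti := tl _ (ltn_ord i).
rewrite (bigD1 (Ordinal ti)) //= big1 ?addr0 => [|a na]; rewrite !mxE /permF.
  rewrite rmorph_nat -natrM mulnb eqxx /=; congr (_%:R).
  congr nat_of_bool; apply/eqP/eqP => [e|->] //.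
  by apply: val_inj; rewrite /= -(tK _ (ltn_ord i)) e tK.
move: na; rewrite -val_eqE /= => /negPf ->; exact: mul0r.
Qed.

Lemma lt_iota (q : nat) : (q \in iota 0 N) = (q < N)%N.
Proof. by rewrite mem_iota. Qed.

Lemma cgate_gate (g : cgate) : gate_on (iota 0 N) g ->
  exists G : gate R N, gate_ok G /\ forall s, gate_mx G *m ket s = ket (ceval g s).
Proof.
(* What is left for each gate is a finite check on its own one, two or three bits. *)
have red tau k (qs : seq nat) G : all (fun q => q < N)%N qs -> size qs = k ->
  gate_on qs g -> gate_mx G = embed N qs (nmx k (permF tau)) ->
  (forall (z : 'I_(2 ^ N)) s, (bval s qs == tau (bval (qbit z) qs)) =
     all (fun q => qbit z q == ceval g s q) qs) ->
  forall s, gate_mx G *m ket s = ket (ceval g s).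
  move=> hqs sz cg -> H s; apply/matrixP => z j; rewrite ord1 mul_ket embed_nmx //.
  rewrite mxE (@eq_idx_split z s _ qs) //; last by move=> i; apply: ceval_out.
  by rewrite /permF H; case: agree_outside.
case: g red => [t|a t|a b t] red; rewrite /gate_on /= ?inE ?andbT ?lt_iota.
- move=> ht; exists (G1 (Ordinal ht) (nmx 1 (permF (fun i => 1 - i)%N))).
  split; first by apply: unitary_permF => i; rewrite expn1; lia.
  apply: (red (fun i => 1 - i)%N 1%N [:: t]) => //=; rewrite ?ht // /gate_on /= ?inE ?eqxx //.
  move=> z s; rewrite updE eqxx.
  by case: (qbit z t); case: (s t).
- move=> /and3P[nat' ha ht].
  (* Bit 0 of the local index is the control; where it is set, bit 1 is flipped. *)
  pose tau i := match i with 1 => 3 | 3 => 1 | i => i end%N.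
  exists (G2 (Ordinal ha) (Ordinal ht) (nmx 2 (permF tau))).
  split.
    split; first by rewrite -val_eqE.
    by apply: unitary_permF => -[|[|[|[|]]]].
  apply: (red tau 2%N [:: a; t]) => //=; rewrite ?ha ?ht // /gate_on /= ?inE ?nat' ?eqxx ?orbT //.
  move=> z s; rewrite !updE eqxx (negPf nat').
  by case: (qbit z a); case: (qbit z t); case: (s a); case: (s t).
rewrite negb_or => /andP[/andP[/andP[nab nat'] nbt]] /and3P[ha hb ht].
exists (Toffoli R (Ordinal ha) (Ordinal hb) (Ordinal ht)); split.
  by rewrite /= !inE -!val_eqE /= negb_or nab nat' nbt.
apply: (red toffoli_perm 3%N [:: a; b; t]) => //=; rewrite ?ha ?hb ?ht // /gate_on /= ?inE.
  by rewrite negb_or nab nat' nbt !eqxx ?orbT.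
move=> z s; rewrite !updE eqxx (negPf nat') (negPf nbt).
by case: (qbit z a); case: (qbit z b); case: (qbit z t); case: (s a); case: (s b); case: (s t).
Qed.

Definition circ (k : nat) (A : 'M[C]_(2 ^ N)) : Prop :=
  exists cc : circuit R N, [/\ circuit_ok cc, circuit_mx cc = A & (size cc <= k)%N].

Lemma circuit_mx_cat (c1 c2 : circuit R N) :
  circuit_mx (c1 ++ c2) = circuit_mx c2 *m circuit_mx c1.
Proof.
rewrite /circuit_mx foldl_cat; move: (foldl _ 1%:M c1) => A.
elim: c2 A => [|g c2 IH] A /=; first by rewrite mul1mx.
by rewrite IH (IH (gate_mx g *m 1%:M)) mulmx1 mulmxA.
Qed.

Lemma circuit_ok_cat (c1 c2 : circuit R N) :
  circuit_ok c1 -> circuit_ok c2 -> circuit_ok (c1 ++ c2).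
Proof. by elim: c1 => //= g c1 IH [h1 h2] h3; split => //; apply: IH. Qed.

Lemma circ1 : circ 0 1%:M.
Proof. by exists [::]. Qed.

Lemma circ_mul k1 k2 A B : circ k1 A -> circ k2 B -> circ (k1 + k2) (B *m A).
Proof.
move=> [c1 [h1 <- l1]] [c2 [h2 <- l2]]; exists (c1 ++ c2); split.
- exact: circuit_ok_cat.
- exact: circuit_mx_cat.
- by rewrite size_cat leq_add.
Qed.

Lemma circ_gate (G : gate R N) : gate_ok G -> circ 1 (gate_mx G).
Proof. by move=> h; exists [:: G]; split => //; rewrite /circuit_mx /= mulmx1. Qed.

Lemma circ_classical cs : all (gate_on (iota 0 N)) cs ->
  exists2 A, circ (size cs) A & forall s, A *m ket s = ket (evals cs s).
Proof.
elim: cs => [_|g cs IH /= /andP[hg /IH[A cA hA]]].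
  by exists 1%:M; [exact: circ1 | move=> s; rewrite mul1mx].
have [G [okG hG]] := cgate_gate hg.
exists (A *m gate_mx G); first by rewrite -add1n; apply: circ_mul => //; apply: circ_gate.
by move=> s; rewrite -mulmxA hG hA.
Qed.

Definition orth (Q : bool -> bool -> R) : Prop :=
  forall x y, Q x false * Q y false + Q x true * Q y true = (x == y)%:R.

(** Controlled [Q], with local bit 0 as control and bit 1 as target. *)
Definition cuF (Q : bool -> bool -> R) (i j : nat) : C :=
  if odd i && odd j then (Q (odd i./2) (odd j./2))%:C else (i == j)%:R.

Lemma conj_real (x : R) : Num.conj (x%:C) = x%:C :> C.
Proof. by apply: conj_Creal; rewrite complex_real. Qed.

Lemma unitary_cu Q : orth Q -> unitary_mx (nmx 2 (cuF Q)).
Proof.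
move=> oQ; apply/matrixP => i j; rewrite !mxE.
under eq_bigr => k _ do rewrite !mxE.
rewrite -(big_mkord xpredT (fun k => cuF Q i k * Num.conj (cuF Q j k))).
rewrite (_ : index_iota 0 (2 ^ 2) = [:: 0; 1; 2; 3])%N // !big_cons big_nil.
have oQc x y : (Q x false)%:C * (Q y false)%:C + (Q x true)%:C * (Q y true)%:C
   = (x == y)%:R :> C.
  by rewrite -!rmorphM -rmorphD oQ rmorph_nat.
rewrite -val_eqE /=.
case: i => -[|[|[|[|//]]]] hi; case: j => -[|[|[|[|//]]]] hj;
  rewrite /cuF /= ?conj_real ?rmorph_nat ?mul1r ?mul0r ?mulr0 ?mulr1 ?add0r ?addr0 ?oQc //.
Qed.

Lemma circ_cu (r t : nat) Q : (r < N)%N -> (t < N)%N -> r != t -> orth Q ->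
  exists2 A, circ 1 A & forall s, A *m ket s =
    if s r then \sum_(b : bool) (Q b (s t))%:C *: ket (upd s t b) else ket s.
Proof.
move=> hr ht nrt oQ.
exists (gate_mx (G2 (Ordinal hr) (Ordinal ht) (nmx 2 (cuF Q)))).
  by apply: circ_gate; split; [rewrite -val_eqE | apply: unitary_cu].
move=> s; apply/matrixP => z j; rewrite ord1 mul_ket embed_nmx //=; last by rewrite hr ht.
have out b (i : nat) : i \notin [:: r; t] -> upd s t b i = s i.
  by rewrite !inE negb_or updE => /andP[_ /negPf ->].
have out0 (i : nat) : i \notin [:: r; t] -> s i = s i by [].
have hs : all (fun q => q < N)%N [:: r; t] by rewrite /= hr ht.
rewrite /cuF !odd_bit !half_bit !muln0 !addn0 !oddb.
case sr: (s r).
  rewrite big_bool /= !mxE !(eq_idx_split z hs (out _)) /= !updE eqxx (negPf nrt) sr.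
  case: agree_outside; last by rewrite !mulr0 addr0.
  by case: (qbit z r); case: (qbit z t); case: (s t);
     rewrite /= ?mulr0 ?mulr1 ?addr0 ?add0r.
rewrite mxE (eq_idx_split z hs out0) /= sr; case: agree_outside => //.
by case: (qbit z r); case: (qbit z t); case: (s t).
Qed.

End Bridge.

(** * Permutations and rotations of pairs *)

Section Logical.
Local Open Scope ring_scope.
Local Open Scope complex_scope.
Variable R : realType.
Local Notation C := (R[i]).
Variables N n : nat.
Implicit Types (S : nat -> state) (W : 'M[C]_(2 ^ n)) (phi pi : nat -> nat).
Implicit Types (Z : nat -> bool) (Q : bool -> bool -> R).

Definition prm phi : 'M[C]_(2 ^ n) := \matrix_(i, j) (i == phi j :> nat)%:R.

Lemma prm_id : prm id = 1%:M.
Proof. by apply/matrixP => i j; rewrite !mxE. Qed.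

Lemma eq_prm phi psi : (forall x, (x < 2 ^ n)%N -> phi x = psi x) -> prm phi = prm psi.
Proof. by move=> h; apply/matrixP => i j; rewrite !mxE h. Qed.

(** Entries are functions of a natural number as column, so that multiplying by a permutation on the
    right is a mere substitution. *)
Lemma mul_fmx_prm p (F : 'I_p -> nat -> C) phi :
  (forall x, (x < 2 ^ n)%N -> (phi x < 2 ^ n)%N) ->
  (\matrix_(i, j) F i j : 'M[C]_(p, 2 ^ n)) *m prm phi = \matrix_(i, j) F i (phi j).
Proof.
move=> h; apply/matrixP => i j; rewrite !mxE.
rewrite (bigD1 (Ordinal (h _ (ltn_ord j)))) //= big1 ?addr0 ?mxE ?eqxx ?mulr1 //.
by move=> k; rewrite -val_eqE /= => /negPf nk; rewrite !mxE nk mulr0.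
Qed.

Lemma prm_mul phi psi : (forall x, (x < 2 ^ n)%N -> (psi x < 2 ^ n)%N) ->
  prm phi *m prm psi = prm (phi \o psi).
Proof. exact: (mul_fmx_prm (fun (i : 'I_(2 ^ n)) j => (i == phi j :> nat)%:R)). Qed.

(* Rotates each pair [x], [pi x] with [Z x] in the plane whose two axes are
   distinguished by the parity of the index. *)
Definition rotmx Z pi Q : 'M[C]_(2 ^ n) :=
  \matrix_(i, j) if Z i then (Q (odd i) (odd j))%:C * ((j == i) || (j == pi i :> nat))%:R
                 else (i == j)%:R.

Definition pairing Z pi : Prop := forall x, (x < 2 ^ n)%N -> Z x ->
  [/\ (pi x < 2 ^ n)%N, Z (pi x), pi (pi x) = x & odd (pi x) = ~~ odd x].

Lemma mul_fmx_rot p (F : 'I_p -> nat -> C) Z pi Q : pairing Z pi ->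
  (\matrix_(i, j) F i j : 'M[C]_(p, 2 ^ n)) *m rotmx Z pi Q =
  \matrix_(i, j) if Z j then F i j * (Q (odd j) (odd j))%:C
                             + F i (pi j) * (Q (~~ odd j) (odd j))%:C
                 else F i j.
Proof.
move=> pr; apply/matrixP => i j; rewrite !mxE.
case: (boolP (Z j)) => Zj; last first.
  rewrite (bigD1 j) //= big1 ?addr0 ?mxE ?(negPf Zj) ?eqxx ?mulr1 //.
  move=> k nk; rewrite !mxE (negPf nk) (eq_sym j k) (negPf nk).
  case: ifP => Zk; last by rewrite mulr0.
  have [_ Zpk _ _] := pr _ (ltn_ord k) Zk.
  case: eqP => [e|_]; last by rewrite !mulr0.
  by rewrite e Zpk in Zj.
have [lp Zp pp op] := pr _ (ltn_ord j) Zj.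
have npj : Ordinal lp != j.
  by apply/eqP => /(congr1 (odd \o val)) /=; rewrite op; case: odd.
rewrite (bigD1 j) //= (bigD1 (Ordinal lp)) //= big1 ?addr0; last first.
  move=> k /andP[nkj nkp]; rewrite !mxE (negPf nkj) (eq_sym j k) (negPf nkj).
  case: ifP => Zk; last by rewrite mulr0.
  have [_ _ ppk _] := pr _ (ltn_ord k) Zk.
  case: eqP => [e|_]; last by rewrite !mulr0.
  by case/eqP: nkp; apply: val_inj; rewrite /= e.
rewrite !mxE Zj /= Zp !eqxx /= mulr1 pp eqxx orbT mulr1 op //.
Qed.

Lemma rot_sub1 Z pi Q : pairing Z pi -> forall i j : 'I_(2 ^ n),
  ~~ (Z i && Z j) -> (rotmx Z pi Q - 1%:M) i j = 0.
Proof.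
move=> pr i j nz; rewrite !mxE; case: ifP => Zi; last by rewrite subrr.
move: nz; rewrite Zi /= => nZj; have [_ Zp _ _] := pr _ (ltn_ord i) Zi.
case: (altP (i =P j)) => [e|nij]; first by rewrite -e Zi in nZj.
rewrite eq_sym (negPf nij); case: eqP => [e|_]; first by rewrite e Zp in nZj.
by rewrite mulr0 subr0.
Qed.

(** A rotation differs from the identity only where row and column both lie in its support, so the
    two differences never meet. *)
Lemma mul_rot_sub1 Z1 Z2 pi1 pi2 Q1 Q2 : pairing Z1 pi1 -> pairing Z2 pi2 ->
  (forall x, (x < 2 ^ n)%N -> ~~ (Z1 x && Z2 x)) ->
  (rotmx Z1 pi1 Q1 - 1%:M) *m (rotmx Z2 pi2 Q2 - 1%:M) = 0.
Proof.
move=> p1 p2 dj; apply/matrixP => i j; rewrite mxE [RHS]mxE; apply: big1 => k _.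
have := dj _ (ltn_ord k); rewrite negb_and => /orP[nz|nz].
  by rewrite rot_sub1 ?mul0r // (negPf nz) andbF.
by rewrite [X in _ * X]rot_sub1 ?mulr0 // (negPf nz).
Qed.

(** Expands the vanishing product of differences. The right-hand side is symmetric, whence
    commutation; it also splits a rotation along a partition of its support. *)
Lemma rot_mul_disjoint Z1 Z2 pi1 pi2 Q1 Q2 : pairing Z1 pi1 -> pairing Z2 pi2 ->
  (forall x, (x < 2 ^ n)%N -> ~~ (Z1 x && Z2 x)) ->
  rotmx Z1 pi1 Q1 *m rotmx Z2 pi2 Q2 = rotmx Z1 pi1 Q1 + rotmx Z2 pi2 Q2 - 1%:M.
Proof.
move=> p1 p2 dj; have := mul_rot_sub1 Q1 Q2 p1 p2 dj.
rewrite mulmxBl !mulmxBr !mulmx1 !mul1mx => e; apply/eqP; rewrite -subr_eq0 -e.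
by rewrite !opprB !opprD !addrA; apply/eqP; congr (_ + _); exact: addrAC.
Qed.

Lemma rot_comm Z1 Z2 pi1 pi2 Q1 Q2 : pairing Z1 pi1 -> pairing Z2 pi2 ->
  (forall x, (x < 2 ^ n)%N -> ~~ (Z1 x && Z2 x)) ->
  rotmx Z1 pi1 Q1 *m rotmx Z2 pi2 Q2 = rotmx Z2 pi2 Q2 *m rotmx Z1 pi1 Q1.
Proof.
move=> p1 p2 dj; rewrite !rot_mul_disjoint // 1?[X in X - _]addrC //.
by move=> x hx; rewrite andbC dj.
Qed.

Lemma rot_split Z Z1 Z2 pi Q : pairing Z1 pi -> pairing Z2 pi ->
  (forall x, (x < 2 ^ n)%N -> ~~ (Z1 x && Z2 x)) ->
  (forall x, (x < 2 ^ n)%N -> Z x = Z1 x || Z2 x) ->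
  rotmx Z pi Q = rotmx Z1 pi Q *m rotmx Z2 pi Q.
Proof.
move=> p1 p2 dj hZ; rewrite rot_mul_disjoint //; apply/matrixP => i j; rewrite !mxE.
rewrite hZ //; have := dj _ (ltn_ord i).
case: (Z1 i); case: (Z2 i) => //= _; rewrite ?addrK //.
by rewrite addrAC subrr add0r.
Qed.

Lemma rot_pred0 Z pi Q : (forall x, (x < 2 ^ n)%N -> Z x = false) -> rotmx Z pi Q = 1%:M.
Proof. by move=> h; apply/matrixP => i j; rewrite !mxE h. Qed.

(** Relabelling by [phi] carries the pairs of [pi] to those of [pi']. Parity has to be kept because
    it selects the entry of [Q]. *)
Lemma rot_intertwine phi Z pi Z' pi' Q :
  (forall x, (x < 2 ^ n)%N -> (phi x < 2 ^ n)%N) ->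
  (forall x y, (x < 2 ^ n)%N -> (y < 2 ^ n)%N -> phi x = phi y -> x = y) ->
  (forall x, (x < 2 ^ n)%N -> Z' (phi x) = Z x) ->
  (forall x, (x < 2 ^ n)%N -> odd (phi x) = odd x) ->
  (forall x, (x < 2 ^ n)%N -> Z x -> (pi x < 2 ^ n)%N /\ pi' (phi x) = phi (pi x)) ->
  prm phi *m rotmx Z pi Q = rotmx Z' pi' Q *m prm phi.
Proof.
move=> hl hi hZ ho hp.
pose f (x : 'I_(2 ^ n)) := Ordinal (hl _ (ltn_ord x)).
have fi : injective f by move=> x y [] /hi e; apply: val_inj; apply: e.
have [g fK gK] := injF_bij fi.
apply/matrixP => i j; rewrite [RHS](congr1 (fun A : 'M__ => A i j)
   (mul_fmx_prm (fun (i : 'I_(2 ^ n)) j => if Z' i then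
   (Q (odd i) (odd j))%:C * ((j == i) || (j == pi' i :> nat))%:R else (i == j :> nat)%:R) hl)).
rewrite -(gK i); move: (g i) => k {i}; rewrite !mxE.
rewrite (bigD1 k) //= big1 ?addr0; last first.
  move=> l nl; rewrite mxE; case: eqP => [/hi e|_]; last by rewrite mul0r.
  by case/eqP: nl; apply/val_inj/esym/e.
rewrite !mxE eqxx mul1r hZ // !ho //.
have eqphi (x y : nat) : (x < 2 ^ n)%N -> (y < 2 ^ n)%N -> (phi x == phi y) = (x == y).
  by move=> hx hy; apply/eqP/eqP => [/hi->|->].
case: ifP => Zk; last by rewrite eqphi.
have [hpk ->] := hp _ (ltn_ord k) Zk.
by rewrite !eqphi.
Qed.

(** * Circuits realizing a matrix on embedded data *)

Definition V S : 'M[C]_(2 ^ N, 2 ^ n) := \matrix_(z, x) (z == idx N (S x))%:R.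

Lemma mul_V (A : 'M[C]_(2 ^ N)) S z x : (A *m V S) z x = (A *m ket R N (S x)) z 0.
Proof.
rewrite !mxE; apply: eq_bigr => k _; by rewrite !mxE.
Qed.

(* [S] and [S'] embed the data basis into the full register, ancillas included. *)
Definition impl S S' (k : nat) W : Prop :=
  exists2 A : 'M[C]_(2 ^ N), circ k A & A *m V S = V S' *m W.

Lemma impl_mul S S' S'' k1 k2 W1 W2 :
  impl S S' k1 W1 -> impl S' S'' k2 W2 -> impl S S'' (k1 + k2) (W2 *m W1).
Proof.
move=> [A cA hA] [B cB hB]; exists (B *m A); first exact: circ_mul.
by rewrite -mulmxA hA mulmxA hB mulmxA.
Qed.

Lemma impl_leq S S' k k' W : (k <= k')%N -> impl S S' k W -> impl S S' k' W.
Proof.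
move=> le [A [cc [h1 h2 h3]] hA]; exists A => //; exists cc; split => //.
exact: leq_trans le.
Qed.

Lemma impl_prm S S' cs phi : all (gate_on (iota 0 N)) cs ->
  (forall x, (x < 2 ^ n)%N -> (phi x < 2 ^ n)%N) ->
  (forall x, (x < 2 ^ n)%N -> evals cs (S x) = S' (phi x)) ->
  impl S S' (size cs) (prm phi).
Proof.
move=> cc hl h; have [A cA hA] := circ_classical R cc.
exists A => //; rewrite (mul_fmx_prm (fun z x => (z == idx N (S' x))%:R) hl).
by apply/matrixP => z x; rewrite mul_V hA h // !mxE.
Qed.

Lemma impl_id S S' cs : all (gate_on (iota 0 N)) cs ->
  (forall x, (x < 2 ^ n)%N -> evals cs (S x) = S' x) ->
  impl S S' (size cs) 1%:M.
Proof. by move=> cc h; rewrite -prm_id; apply: impl_prm. Qed.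

(** With the condition in [r] and the parity in [t], flipping [t] leads from [x] to its partner, so
    a single controlled gate rotates all pairs at once. *)
Lemma impl_rot S r t Z pi Q : (r < N)%N -> (t < N)%N -> r != t -> orth Q ->
  pairing Z pi ->
  (forall x, (x < 2 ^ n)%N -> S x r = Z x) ->
  (forall x, (x < 2 ^ n)%N -> S x t = odd x) ->
  (forall x, (x < 2 ^ n)%N -> Z x -> S (pi x) = upd (S x) t (~~ odd x)) ->
  impl S S 1 (rotmx Z pi Q).
Proof.
move=> hr ht nrt oQ pr hZ ho hp; have [A cA hA] := circ_cu hr ht nrt oQ.
exists A => //; rewrite (mul_fmx_rot (fun z x => (z == idx N (S x))%:R) Q pr).
apply/matrixP => z x; rewrite mul_V hA hZ // ho //.
case: ifP => Zx; last by rewrite !mxE Zx.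
rewrite !mxE Zx big_bool /= !mxE hp //.
have e : upd (S x) t (odd x) = S x by rewrite -ho // upd_id.
case ox : (odd x); rewrite ox in e *; rewrite e /= mulrC [X in _ + X]mulrC //.
by rewrite addrC.
Qed.

End Logical.

(** * Lattice factorization *)

(* A level on [m] qubits acts on the indices below [2 ^ m = 2 * P] only. *)
Definition active (P x : nat) : bool := (x < 2 * P)%N.

Definition partner (P t x : nat) : nat :=
  if odd x then (2 * ((x./2 + (P - t)) %% P))%N else (1 + 2 * ((x./2 + t) %% P))%N.

(** Sends even samples to the lower half and odd ones to the upper half, undoing the offset [t] of
    the latter; [P - t] stands for [- t] modulo [P]. *)
Definition rbf (P t x : nat) : nat :=
  if (x < 2 * P)%N then
    if odd x then (P + (x./2 + (P - t)) %% P)%N else x./2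
  else x.

Section Partner.
Variables P t : nat.
Hypotheses (P_gt0 : (0 < P)%N) (tP : (t <= P)%N).

Lemma partner_lt x : (partner P t x < 2 * P)%N.
Proof.
have h y : (y %% P < P)%N by rewrite ltn_mod.
rewrite /partner; case: odd; have := h (x./2 + t)%N; have := h (x./2 + (P - t))%N; lia.
Qed.

Lemma odd_partner x : odd (partner P t x) = ~~ odd x.
Proof.
by rewrite /partner; case: (odd x); rewrite mul2n /= odd_double.
Qed.

Lemma half_partner x :
  (partner P t x)./2 = ((x./2 + (if odd x then P - t else t)) %% P)%N.
Proof. by rewrite /partner; case: (odd x); rewrite mul2n ?doubleK ?(half_bit_double _ true). Qed.

Lemma partnerK x : (x < 2 * P)%N -> partner P t (partner P t x) = x.
Proof.
move=> hx; rewrite {1}/partner odd_partner half_partner.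
have hp : (x./2 < P)%N by lia.
case: (boolP (odd x)) => ox /=.
  by rewrite modnDml -addnA subnK // modnDr modn_small // -{2}(bit_half x) ox.
by rewrite modnDml -addnA subnKC // modnDr modn_small // -{2}(bit_half x) (negPf ox).
Qed.

Lemma pairing_partner n (Z : nat -> bool) : (2 * P <= 2 ^ n)%N ->
  (forall x, Z x -> (x < 2 * P)%N) ->
  (forall x, (x < 2 * P)%N -> Z x -> Z (partner P t x)) ->
  pairing n Z (partner P t).
Proof.
move=> hn h1 h2 x hx Zx; split.
- exact: leq_trans (partner_lt x) hn.
- by apply: h2 => //; apply: h1.
- by apply: partnerK; apply: h1.
- exact: odd_partner.
Qed.

End Partner.

Section Lattice.
Local Open Scope ring_scope.
Local Open Scope complex_scope.
Variable R : realType.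
Local Notation C := (R[i]).
Variables (n P : nat).
Hypotheses (P_gt0 : (0 < P)%N) (Pn : (2 * P <= 2 ^ n)%N).
Implicit Types (a b : nat -> R) (Q : bool -> bool -> R) (t J : nat).

Fixpoint rot_chain (Zf : nat -> nat -> bool) t (l : seq (bool -> bool -> R)) : 'M[C]_(2 ^ n) :=
  if l is Q :: l' then rot_chain Zf t.+1 l' *m rotmx n (Zf t) (partner P t) Q else 1%:M.

Fixpoint orths (l : seq (bool -> bool -> R)) : Prop :=
  if l is Q :: l' then orth Q /\ orths l' else True.

(* Row [r] of the transform with even taps [a] and odd taps [b], the odd samples
   being advanced by [t]. *)
Definition polyphase_row a b J t (r c : nat) : R :=
  if odd c then \sum_(j < J.+1) b j * (c./2 == (r + j + t) %% P)%N%:R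
  else \sum_(j < J.+1) a j * (c./2 == (r + j) %% P)%N%:R.

(** The rows from [P] on hold the mirror filter [wavelet_g]: reversing [2 * J.+1] taps exchanges
    even and odd ones, so its even taps are [b (J - j)] and its odd taps [- a (J - j)]. *)
Definition polyphase_mx a b J t : 'M[C]_(2 ^ n) :=
  \matrix_(r, c) if (r < 2 * P)%N && (c < 2 * P)%N then
     (if (r < P)%N then polyphase_row a b J t r c
      else polyphase_row (fun j => b (J - j)%N) (fun j => - a (J - j)%N) J t (r - P) c)%:C
   else (r == c)%:R.

Definition qmx (x y z w : R) (i j : bool) : R :=
  if i then (if j then w else z) else (if j then y else x).

(** The conditionals extend [a'] by zero past [J] and delay [b'] by one tap, with a zero in
    front. *)
Lemma sum_shift J (a a' b' : nat -> R) (k1 k2 : R) (F : nat -> R) :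
  (forall j, (j <= J.+1)%N -> a j = k1 * (if (j <= J)%N then a' j else 0)
                                    + k2 * (if (0 < j)%N then b' j.-1 else 0)) ->
  \sum_(j < J.+2) a j * F j =
    (\sum_(j < J.+1) a' j * F j) * k1 + (\sum_(j < J.+1) b' j * F j.+1) * k2.
Proof.
move=> h.
rewrite (eq_bigr (fun j : 'I_J.+2 => (if (j <= J)%N then a' j else 0) * F j * k1
   + (if (0 < j)%N then b' j.-1 else 0) * F j * k2)); last first.
  by move=> j _; rewrite h; [ring | rewrite -ltnS].
rewrite big_split /= -!mulr_suml; congr (_ * _ + _ * _).
  rewrite big_ord_recr /= ltnn mul0r addr0; apply: eq_bigr => j _ /=.
  by rewrite -ltnS ltn_ord.
by rewrite big_ord_recl /= mul0r add0r.
Qed.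

Lemma eq_mod_small p x : (p < P)%N -> (p == x %% P)%N = (p == x %[mod P])%N.
Proof. by move=> h; rewrite (modn_small h). Qed.

(** The delay of [b'] by one tap is absorbed by the larger offset [t.+1] of the odd samples. *)
Lemma polyphase_row_step J t a b a' b' (u v : R) r c : (t <= P)%N -> (c < 2 * P)%N ->
  (forall j, (j <= J.+1)%N -> a j = u * (if (j <= J)%N then a' j else 0)
                                    + (- v) * (if (0 < j)%N then b' j.-1 else 0)) ->
  (forall j, (j <= J.+1)%N -> b j = v * (if (j <= J)%N then a' j else 0)
                                    + u * (if (0 < j)%N then b' j.-1 else 0)) ->
  polyphase_row a b J.+1 t r c =
    polyphase_row a' b' J t.+1 r c * qmx u v (- v) u (odd c) (odd c) +
    polyphase_row a' b' J t.+1 r (partner P t c) * qmx u v (- v) u (~~ odd c) (odd c).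
Proof.
move=> tP hc ha hb; rewrite /polyphase_row odd_partner half_partner.
have hp : (c./2 < P)%N by lia.
have hm y : (y %% P < P)%N by rewrite ltn_mod.
case: (odd c) => /=.
  rewrite (sum_shift (fun j => (c./2 == (r + j + t) %% P)%N%:R) hb) addrC.
  congr (_ * _ + _ * _); apply: eq_bigr => j _; congr (_ * _%:R).
    by rewrite addnS addnS addSn.
  congr nat_of_bool; rewrite (eq_mod_small _ hp) -[RHS](eqn_modDr t).
  by rewrite -(addnA c./2) subnK // modnDr.
rewrite (sum_shift (fun j => (c./2 == (r + j) %% P)%N%:R) ha).
congr (_ + _ * _); apply: eq_bigr => j _; congr (_ * _%:R); congr nat_of_bool.
rewrite (eq_mod_small _ hp) -[LHS](eqn_modDr t).
by rewrite !addnS !addSn.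
Qed.

Lemma pairing_active t : (t <= P)%N -> pairing n (active P) (partner P t).
Proof.
move=> tP; apply: pairing_partner => // x hx _; exact: partner_lt.
Qed.

Lemma polyphase_mx_step J t a b a' b' (u v : R) : (t <= P)%N ->
  (forall j, (j <= J.+1)%N -> a j = u * (if (j <= J)%N then a' j else 0)
                                    + (- v) * (if (0 < j)%N then b' j.-1 else 0)) ->
  (forall j, (j <= J.+1)%N -> b j = v * (if (j <= J)%N then a' j else 0)
                                    + u * (if (0 < j)%N then b' j.-1 else 0)) ->
  polyphase_mx a b J.+1 t = polyphase_mx a' b' J t.+1 *m rotmx n (active P) (partner P t) (qmx u v (- v) u).
Proof.
move=> tP ha hb.
rewrite (mul_fmx_rot (fun (r : 'I_(2 ^ n)) (c : nat) =>
  if (r < 2 * P)%N && (c < 2 * P)%N then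
     (if (r < P)%N then polyphase_row a' b' J t.+1 r c
      else polyphase_row (fun j => b' (J - j)%N) (fun j => - a' (J - j)%N) J t.+1 (r - P) c)%:C
   else (r == c :> nat)%:R) _ (pairing_active tP)).
apply/matrixP => r c; rewrite !mxE /active.
case: (boolP (c < 2 * P)%N) => hc; last by rewrite andbF.
have lp := partner_lt P_gt0 tP c.
rewrite lp !andbT; case: (boolP (r < 2 * P)%N) => hr; last first.
  rewrite -val_eqE /=.
  have -> : (r == c :> nat) = false by apply/eqP => e; move: hr; rewrite e hc.
  have -> : (r == partner P t c :> nat) = false by apply/eqP => e; move: hr; rewrite e lp.
  by rewrite !mul0r addr0.
rewrite -!rmorphM -rmorphD; congr (_%:C); case: ifP => hrP; first exact: polyphase_row_step.
(* Mirrored rows: reversing the taps exchanges the delayed and the undelayed term, so the mirror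
   filter obeys the same recursion with the same [u] and [v]. *)
apply: polyphase_row_step => // j hj.
  rewrite hb ?leq_subr // addrC; congr (_ + _).
    case: (leqP j J) => h; last by have -> : (0 < J.+1 - j)%N = false by lia.
    by rewrite subSn.
  case: j hj => [|j] hj; first by rewrite subn0 ltnn !mulr0.
  by rewrite subSS leq_subr /= mulrNN.
rewrite ha ?leq_subr // opprD addrC mulNr opprK; congr (_ + _).
  case: (leqP j J) => h; last by have -> : (0 < J.+1 - j)%N = false by lia.
  by rewrite subSn.
case: j hj => [|j] hj; first by rewrite subn0 ltnn !mulr0 oppr0.
by rewrite subSS leq_subr /= mulrN.
Qed.

Lemma rbf_lt t x : (x < 2 ^ n)%N -> (rbf P t x < 2 ^ n)%N.
Proof.
move=> hx; rewrite /rbf; case: ifP => // h; have := ltn_mod (x./2 + (P - t)) P.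
rewrite P_gt0; case: odd; lia.
Qed.

(** With one tap pair each active row reads a single pair of samples, so only a permutation of the
    outputs is left. *)
Lemma polyphase_mx_base t a b : (t <= P)%N ->
  polyphase_mx a b 0 t = prm R n (rbf P t)
    *m rotmx n (active P) (partner P t) (qmx (a 0%N) (b 0%N) (b 0%N) (- a 0%N)).
Proof.
move=> tP.
rewrite (mul_fmx_rot (fun (r : 'I_(2 ^ n)) (c : nat) => (r == rbf P t c :> nat)%:R)
  _ (pairing_active tP)).
apply/matrixP => r c; rewrite !mxE /active.
case: (boolP (c < 2 * P)%N) => hc; last first.
  by rewrite andbF /rbf (negPf hc).
have lp := partner_lt P_gt0 tP c; have hp : (c./2 < P)%N by lia.
have hm y : (y %% P < P)%N by rewrite ltn_mod.
rewrite /rbf hc lp odd_partner half_partner /polyphase_row !big_ord1 !addn0 subn0.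
rewrite -val_eqE /=; case: (boolP (r < 2 * P)%N) => hr; last first.
  have -> : (r == c :> nat) = false by apply/eqP => e; move: hr; rewrite e hc.
  have h3 y : (y < 2 * P)%N -> (r == y :> nat) = false.
    by move=> hy; apply/eqP => e; move: hr; rewrite e hy.
  have h4 := hm (c./2 + (P - t))%N; have h5 := hm (c./2 + t)%N.
  by case: (odd c) => /=; rewrite !h3 ?mul0r ?addr0 //; try lia;
     have := hm ((c./2 + t) %% P + (P - t))%N; lia.
rewrite -!(rmorph_nat (real_complex R)) -!rmorphM -rmorphD /=; congr (_%:C).
case: (odd c) => /=; case: (ltnP r P) => hrP.
- have -> : (r == P + (c./2 + (P - t)) %% P :> nat)%N = false.
    by apply/eqP => e; move: hrP; rewrite e; lia.
  rewrite mul0r add0r mulrC; congr (_%:R * _); congr nat_of_bool.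
  rewrite (eq_mod_small _ hp) (eq_mod_small _ hrP) -[RHS](eqn_modDr t).
  by rewrite -(addnA c./2) subnK // modnDr eq_sym.
- have h4 := hm (c./2 + (P - t))%N.
  have -> : (r == (c./2 + (P - t)) %% P :> nat)%N = false.
    by apply/eqP => e; move: hrP; rewrite e; lia.
  rewrite mul0r addr0 mulrC; congr (_%:R * _); congr nat_of_bool.
  have -> : (r == P + (c./2 + (P - t)) %% P :> nat)%N
      = (r - P == (c./2 + (P - t)) %% P)%N by lia.
  have hrP' : (r - P < P)%N by lia.
  rewrite (eq_mod_small _ hp) (eq_mod_small _ hrP') -[RHS](eqn_modDr t).
  by rewrite -(addnA c./2) subnK // modnDr eq_sym.
- rewrite modn_small // eq_sym mulrC.
  rewrite (_ : (r == P + _ :> nat)%N = false) ?mul0r ?addr0 //.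
  by apply/eqP => e; move: hrP; rewrite {1}e; lia.
rewrite modn_small; last by lia.
rewrite (_ : (r == c./2 :> nat) = false) ?mul0r ?add0r; last first.
  by apply/eqP => e; move: hrP; rewrite {1}e; lia.
rewrite mulrC; congr (_%:R * _); congr nat_of_bool.
rewrite modnDml -addnA subnKC // modnDr modn_small //; lia.
Qed.

(** Orthonormality under even shifts, in terms of even taps [a] and odd taps [b] that are meant to
    vanish beyond [J]. *)
Definition acorr J a b := forall k,
  \sum_(j < J.+1) (a j * a (j + k)%N + b j * b (j + k)%N) = (k == 0)%N%:R.

(** A direction parallel to [(x, y)] and orthogonal to [(z, w)]; the two demands agree because these
    vectors are orthogonal. It is normalized at the end. *)
Lemma unit_direction (x y z w : R) : x * z + y * w = 0 ->
  exists u v : R, [/\ u ^+ 2 + v ^+ 2 = 1, u * y - v * x = 0 & u * z + v * w = 0].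
Proof.
move=> o.
suff [u [v [nz h1 h2]]] : exists u v : R,
    [/\ u ^+ 2 + v ^+ 2 != 0, u * y - v * x = 0 & u * z + v * w = 0].
  have p : 0 < u ^+ 2 + v ^+ 2 by rewrite lt_def nz addr_ge0 ?sqr_ge0.
  set s := Num.sqrt (u ^+ 2 + v ^+ 2).
  have s2 : s ^+ 2 = u ^+ 2 + v ^+ 2 by rewrite sqr_sqrtr // ltW.
  have s0 : s != 0 by rewrite gt_eqF // sqrtr_gt0.
  exists (u / s), (v / s); split.
  - by rewrite !expr_div_n -mulrDl s2 divff.
  - by rewrite !(mulrAC _ s^-1) -mulrBl h1 mul0r.
  - by rewrite !(mulrAC _ s^-1) -mulrDl h2 mul0r.
have sq0 (p q : R) : p ^+ 2 + q ^+ 2 = 0 -> p = 0 /\ q = 0.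
  move=> /eqP; rewrite paddr_eq0 ?sqr_ge0 // !sqrf_eq0 => /andP[/eqP-> /eqP->].
  by [].
have [/sq0[x0 y0]|/eqP nz] := eqVneq (x ^+ 2 + y ^+ 2) 0; last first.
  by exists x, y; split; [apply/eqP | ring | ].
have [/sq0[z0 w0]|nz] := eqVneq (z ^+ 2 + w ^+ 2) 0.
  exists 1, 0; rewrite x0 y0 z0 w0; split; last 2 first; try by ring.
  by rewrite expr0n /= expr1n addr0 oner_neq0.
(* With [(x, y)] zero only the orthogonality to [(z, w)] is left to meet. *)
exists (- w), z; rewrite x0 y0; split; try by ring.
by rewrite sqrrN addrC.
Qed.

(* The rotation is chosen so that it kills the last even tap and the first odd
   tap; what remains has one tap pair less, the odd taps being delayed by one. *)
Lemma lattice J t a b : (forall j, (J < j)%N -> a j = 0 /\ b j = 0) ->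
  acorr J a b -> (t + J <= P)%N ->
  exists l, [/\ size l = J.+1, orths l
    & polyphase_mx a b J t = prm R n (rbf P (t + J)) *m rot_chain (fun=> active P) t l].
Proof.
elim: J t a b => [|J IH] t a b hz hc hP.
  rewrite addn0 in hP *.
  exists [:: qmx (a 0%N) (b 0%N) (b 0%N) (- a 0%N)]; split => //=.
    split => // x y; have := hc 0%N; rewrite big_ord1 /= => e.
    by case: x; case: y => /=; rewrite -?e; ring.
  by rewrite mul1mx polyphase_mx_base.
(* At the largest lag only the product of the first and the last tap pair remains. *)
have o : a 0%N * a J.+1 + b 0%N * b J.+1 = 0.
  have := hc J.+1; rewrite big_ord_recl /= big1 ?addr0 // => j _.
  have [-> ->] : a (bump 0 j + J.+1)%N = 0 /\ b (bump 0 j + J.+1)%N = 0.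
    by apply: hz; rewrite /bump /=; lia.
  by rewrite !mulr0 addr0.
have [u [v [uv h0 hJ]]] := unit_direction o.
pose a' j := u * a j + v * b j.
pose bb j := u * b j - v * a j.
pose b' j := bb j.+1.
have hz' j : (J < j)%N -> a' j = 0 /\ b' j = 0.
  move=> hj; have [z1 z2] := hz j.+1 hj; rewrite /b' /bb z1 z2.
  split; last by ring.
  move: hj; rewrite leq_eqVlt /a' => /orP[/eqP <- //|hj].
  by have [-> ->] := hz _ hj; ring.
have bb0 : bb 0%N = 0 by [].
(* The rotation preserves every product of two tap pairs, and dropping the vanishing first tap of
   [bb] only reindexes its sum. *)
have hc' : acorr J a' b'.
  move=> k; rewrite -hc big_split /=.
  have -> : \sum_(j < J.+1) a' j * a' (j + k)%N = \sum_(j < J.+2) a' j * a' (j + k)%N.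
    by rewrite [RHS]big_ord_recr /=; have [-> _] := hz' J.+1 (ltnSn _); rewrite mul0r addr0.
  have -> : \sum_(j < J.+1) b' j * b' (j + k)%N = \sum_(j < J.+2) bb j * bb (j + k)%N.
    by rewrite [RHS]big_ord_recl /= bb0 mul0r add0r.
  rewrite -big_split; apply: eq_bigr => j _ /=; rewrite /a' /bb.
  rewrite -[RHS]mul1r -uv; ring.
have [l [sl ol el]] := IH t.+1 a' b' hz' hc' ltac:(lia).
exists (qmx u v (- v) u :: l); split.
- by rewrite /= sl.
- split => // x y.
  by case: x; case: y => /=; rewrite -?uv; ring.
rewrite /= mulmxA addnS -addSn -el; apply: polyphase_mx_step; first by lia.
  move=> j hj.
  have -> : (if (j <= J)%N then a' j else 0) = a' j.
    by case: leqP => // h; have [-> _] := hz' j h.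
  have -> : (if (0 < j)%N then b' j.-1 else 0) = bb j by case: (j).
  by rewrite /a' /bb -[LHS]mul1r -uv; ring.
move=> j hj.
have -> : (if (j <= J)%N then a' j else 0) = a' j.
  by case: leqP => // h; have [-> _] := hz' j h.
have -> : (if (0 < j)%N then b' j.-1 else 0) = bb j by case: (j).
by rewrite /a' /bb -[LHS]mul1r -uv; ring.
Qed.

End Lattice.

(** * Block decomposition *)

Section Coordinates.
Variables (L K : nat).
Hypotheses (L_gt0 : 0 < L) (K_gt0 : 0 < K).
Local Notation P := (K * L).

(** Coordinates of a sample: parity [s], position [u] in its block of length [L], block number
    [q]. *)
Definition enc (s : bool) (u q : nat) : nat := s + 2 * (u + L * q).
Definition lo (x : nat) : nat := x./2 %% L.
Definition hi (x : nat) : nat := x./2 %/ L.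

Lemma odd_enc s u q : odd (enc s u q) = s.
Proof. exact: odd_bit. Qed.

Lemma half_enc s u q : (enc s u q)./2 = u + L * q.
Proof. exact: half_bit. Qed.

Lemma lo_enc s u q : u < L -> lo (enc s u q) = u.
Proof. by move=> h; rewrite /lo half_enc mulnC addnC modnMDl modn_small. Qed.

Lemma hi_enc s u q : u < L -> hi (enc s u q) = q.
Proof. by move=> h; rewrite /hi half_enc mulnC divnDMl // divn_small. Qed.

Lemma enc_dec x : enc (odd x) (lo x) (hi x) = x.
Proof.
by rewrite /enc /lo /hi -[RHS]bit_half [in RHS](divn_eq x./2 L); congr (_ + 2 * _); ring.
Qed.

Lemma active_enc s u q : u < L -> q < K -> active P (enc s u q).
Proof.
move=> hu hq; rewrite /active /enc.
have : L * q.+1 <= K * L by rewrite mulnC leq_mul2r hq orbT.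
by rewrite mulnS; case: s; lia.
Qed.

Lemma lo_lt x : lo x < L.
Proof. by rewrite ltn_mod. Qed.

Lemma hi_lt x : active P x -> hi x < K.
Proof. by rewrite /active /hi => h; rewrite ltn_divLR //; lia. Qed.

Lemma modP u y : u < L -> (u + L * y) %% P = u + L * (y %% K).
Proof.
move=> hu; rewrite {1}(divn_eq y K).
have -> : u + L * (y %/ K * K + y %% K) = y %/ K * (K * L) + (u + L * (y %% K)) by ring.
rewrite modnMDl modn_small //.
have hy : y %% K < K by rewrite ltn_mod.
have : L * (y %% K).+1 <= K * L by rewrite mulnC leq_mul2r hy orbT.
by rewrite mulnS; lia.
Qed.

Lemma encP (Pr : nat -> Prop) : (forall x, ~~ active P x -> Pr x) ->
  (forall s u q, u < L -> q < K -> Pr (enc s u q)) -> forall x, Pr x.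
Proof.
move=> h1 h2 x; case: (boolP (active P x)) => ax; last exact: h1.
by rewrite -(enc_dec x); apply: h2; [exact: lo_lt | exact: hi_lt].
Qed.

(** As [t <= L], a pair reaches at most into the neighbouring block, cyclically. *)
Lemma partner_enc t s u q : t <= L -> u < L -> q < K ->
  partner P t (enc s u q) =
  if s then (if t <= u then enc false (u - t) q
             else enc false (u + L - t) ((q + (K - 1)) %% K))
  else (if u + t < L then enc true (u + t) q
        else enc true (u + t - L) ((q + 1) %% K)).
Proof.
move=> ht hu hq; rewrite /partner odd_enc half_enc.
have LP : L <= K * L by rewrite leq_pmull.
case: s; last first.
  case: ltnP => h.
    have -> : u + L * q + t = (u + t) + L * q by ring.
    by rewrite modP // modn_small.
  have -> : u + L * q + t = (u + t - L) + L * (q + 1) by rewrite mulnDr; lia.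
  by rewrite modP //; lia.
case: leqP => h.
  have -> : u + L * q + (K * L - t) = (u - t) + L * (q + K).
    by rewrite mulnDr (mulnC L K); lia.
  by rewrite modP ?modnDr ?(modn_small hq) //; lia.
have -> : u + L * q + (K * L - t) = (u + L - t) + L * (q + (K - 1)).
  have -> : K * L = L * (K - 1) + L by rewrite mulnBr (mulnC L K) muln1; lia.
  by rewrite mulnDr; lia.
by rewrite modP //; lia.
Qed.

(** Even samples stay in place, since only the relative shift of the two parities matters. *)
Definition onodd (f g : nat -> nat) (x : nat) : nat :=
  if active P x && odd x then enc true (f (lo x)) (g (hi x)) else x.

Definition psi : nat -> nat := onodd (fun u => (u + 1) %% L) id.
Definition lsh (t : nat) : nat -> nat := onodd (fun u => (u + (L - t)) %% L) id.
Definition hsh : nat -> nat := onodd id (fun q => (q + (K - 1)) %% K).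
Definition hshi : nat -> nat := onodd id (fun q => (q + 1) %% K).
Definition fixh (J x : nat) : nat :=
  if [&& active P x, odd x & lo x + J < L] then enc true (lo x) ((hi x + 1) %% K) else x.

Lemma onodd_enc f g s u q : u < L -> q < K ->
  onodd f g (enc s u q) = if s then enc true (f u) (g q) else enc false u q.
Proof. by move=> hu hq; rewrite /onodd active_enc // odd_enc lo_enc // hi_enc //; case: s. Qed.

Lemma onodd_out f g x : ~~ active P x -> onodd f g x = x.
Proof. by rewrite /onodd => /negPf ->. Qed.

Lemma onodd_lt n f g : (forall u, u < L -> f u < L) -> (forall q, q < K -> g q < K) ->
  2 * P <= 2 ^ n -> forall x, x < 2 ^ n -> onodd f g x < 2 ^ n.
Proof.
move=> hf hg hP; apply: encP => [x ax hx|s u q hu hq hx].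
  by rewrite onodd_out.
rewrite onodd_enc //; case: s hx => // hx.
by apply: leq_trans hP; apply: (active_enc true); [apply: hf | apply: hg].
Qed.

Lemma odd_onodd f g x : odd (onodd f g x) = odd x.
Proof. by rewrite /onodd; case: ifP => // /andP[_ ->]; rewrite odd_enc. Qed.

Let modL u : u %% L < L. Proof. by rewrite ltn_mod. Qed.
Let modK q : q %% K < K. Proof. by rewrite ltn_mod. Qed.

Lemma lshS t x : t < L -> lsh 1 (lsh t x) = lsh t.+1 x.
Proof.
move=> ht; move: x; apply: encP => [x ax|s u q hu hq]; rewrite /lsh.
  by rewrite !onodd_out.
rewrite !(onodd_enc _ _ _ hu hq); case: s; rewrite ?(onodd_enc _ _ _ hu hq) //.
rewrite onodd_enc //; congr enc; rewrite modnDml.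
have -> : u + (L - t) + (L - 1) = u + (L - t.+1) + L by lia.
by rewrite modnDr.
Qed.

Lemma lsh0 x : lsh 0 x = x.
Proof.
move: x; apply: encP => [x ax|s u q hu hq]; rewrite /lsh; first by rewrite onodd_out.
by rewrite onodd_enc // subn0 modnDr modn_small //; case: s.
Qed.

Lemma psi_lshS t x : t < L -> psi (lsh t.+1 x) = lsh t x.
Proof.
move=> ht; move: x; apply: encP => [x ax|s u q hu hq]; rewrite /lsh /psi.
  by rewrite !onodd_out.
rewrite !(onodd_enc _ _ _ hu hq); case: s; rewrite ?(onodd_enc _ _ _ hu hq) //.
rewrite onodd_enc //; congr enc; rewrite modnDml; congr (_ %% _); lia.
Qed.

Lemma iter_psi_lsh t x : t <= L -> iter t psi (lsh t x) = x.
Proof.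
elim: t => [|t IH] ht; first exact: lsh0.
by rewrite iterSr psi_lshS // IH // ltnW.
Qed.

Lemma hshK x : hshi (hsh x) = x.
Proof.
move: x; apply: encP => [x ax|s u q hu hq]; rewrite /hsh /hshi.
  by rewrite !onodd_out.
rewrite !(onodd_enc _ _ _ hu hq); case: s; rewrite ?(onodd_enc _ _ _ hu hq) //.
rewrite onodd_enc //; congr enc; rewrite modnDml -addnA subnK // modnDr.
by rewrite modn_small.
Qed.

(** Subtracting [J] from the whole position borrows from the block number exactly when [u < J].
    [hsh] takes a block from every odd sample; those with [J <= u], which [lsh J] puts at positions
    below [L - J], get it back from [fixh]. *)
Lemma rbf_fixh J x : J < L -> rbf P 0 (fixh J (lsh J (hsh x))) = rbf P J x.
Proof.
move=> hJ; move: x; apply: encP => [x ax|s u q hu hq]; rewrite /lsh /hsh /fixh.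
  rewrite (onodd_out _ _ ax) (onodd_out _ _ ax) (negPf ax) /=.
  by move: ax; rewrite /rbf /active => /negPf ->.
rewrite !(onodd_enc _ _ _ hu hq); case: s; last first.
  rewrite !(onodd_enc _ _ _ hu hq) odd_enc andbF /rbf odd_enc.
  by [].
rewrite (onodd_enc _ _ _ hu (modK _)) odd_enc active_enc // lo_enc // hi_enc //=.
have e2 : rbf P J (enc true u q) = P + (u + L * q + (P - J)) %% P.
  have := active_enc true hu hq; rewrite /rbf /active => ->.
  by rewrite odd_enc half_enc.
have e1 u' q' : u' < L -> q' < K -> rbf P 0 (enc true u' q') = P + (u' + L * q').
  move=> hu' hq'; have := active_enc true hu' hq'; rewrite /rbf /active => ->.
  by rewrite odd_enc half_enc subn0 modnDr (modP _ hu') modn_small.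
have LP : L <= K * L by rewrite leq_pmull.
rewrite {}e2; case: (leqP J u) => h.
  have -> : u + (L - J) = (u - J) + L by lia.
  rewrite modnDr (modn_small (_ : u - J < L)); last by lia.
  have -> : u - J + J < L by lia.
  rewrite e1 //; last by lia.
  rewrite modnDml -addnA subnK // modnDr modn_small //; congr (_ + _).
  have -> : u + L * q + (K * L - J) = (u - J) + L * (q + K).
    by rewrite mulnDr (mulnC L K); lia.
  by rewrite modP ?modnDr ?(modn_small hq) //; lia.
rewrite (modn_small (_ : u + (L - J) < L)); last by lia.
have -> : (u + (L - J) + J < L) = false by lia.
rewrite e1 //; last by lia.
congr (_ + _).
have -> : u + L * q + (K * L - J) = (u + (L - J)) + L * (q + (K - 1)).
  have -> : K * L = L * (K - 1) + L by rewrite mulnBr (mulnC L K) muln1; lia.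
  by rewrite mulnDr; lia.
by rewrite modP //; lia.
Qed.

(* [inA] and [inB] split the pairs of [partner P t] into those inside a block
   and those across two blocks; [condA] and [condB] are their images under
   the shifts [lsh t] and [lsh t \o hsh], which turn [partner P t] into
   [partner P 0]. *)
Definition inA (t x : nat) : bool :=
  active P x && (if odd x then t <= lo x else lo x + t < L).
Definition inB (t x : nat) : bool :=
  active P x && (if odd x then lo x < t else L <= lo x + t).
Definition condA (t x : nat) : bool := active P x && (lo x + t < L).
Definition condB (t x : nat) : bool := active P x && (L <= lo x + t).

Lemma inA_enc t s u q : u < L -> q < K ->
  inA t (enc s u q) = if s then t <= u else u + t < L.
Proof. by move=> hu hq; rewrite /inA active_enc // odd_enc lo_enc. Qed.

Lemma inB_enc t s u q : u < L -> q < K ->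
  inB t (enc s u q) = if s then u < t else L <= u + t.
Proof. by move=> hu hq; rewrite /inB active_enc // odd_enc lo_enc. Qed.

Lemma condA_enc t s u q : u < L -> q < K -> condA t (enc s u q) = (u + t < L).
Proof. by move=> hu hq; rewrite /condA active_enc // lo_enc. Qed.

Lemma condB_enc t s u q : u < L -> q < K -> condB t (enc s u q) = (L <= u + t).
Proof. by move=> hu hq; rewrite /condB active_enc // lo_enc. Qed.

Let P_gt0 : 0 < P. Proof. by rewrite muln_gt0 K_gt0. Qed.

Lemma active_split t x : inB t x || inA t x = active P x.
Proof. by rewrite /inA /inB; case: active => //=; case: odd; lia. Qed.

(** In each block [inB t'] takes the last [t'] even and the first [t'] odd samples, while [inA t]
    leaves out the last [t] even and the first [t] odd ones. *)
Lemma inAB_disj t t' x : t' <= t -> ~~ (inB t' x && inA t x).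
Proof. by rewrite /inA /inB; case: active => //=; case: odd; lia. Qed.

Lemma leLP t : t <= L -> t <= P.
Proof. by move=> h; apply: leq_trans h _; rewrite leq_pmull. Qed.

Lemma pairing_inA n t : 2 * P <= 2 ^ n -> t <= L -> pairing n (inA t) (partner P t).
Proof.
move=> hn ht; apply: pairing_partner => //; first exact: leLP.
  by move=> x /andP[].
move=> x ax; move: x ax; apply: encP => [x /negP//|s u q hu hq _].
rewrite inA_enc // partner_enc //; case: s => h; rewrite h inA_enc //; lia.
Qed.

Lemma pairing_inB n t : 2 * P <= 2 ^ n -> t <= L -> pairing n (inB t) (partner P t).
Proof.
move=> hn ht; apply: pairing_partner => //; first exact: leLP.
  by move=> x /andP[].
move=> x ax; move: x ax; apply: encP => [x /negP//|s u q hu hq _].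
rewrite inB_enc // partner_enc //; case: s => h.
  by rewrite leqNgt h /= inB_enc //; lia.
by rewrite ltnNge h /= inB_enc //; lia.
Qed.

Lemma pairing_cond n (p : nat -> bool) : 2 * P <= 2 ^ n ->
  pairing n (fun x => active P x && p (lo x)) (partner P 0).
Proof.
move=> hn; apply: pairing_partner => //; first by move=> x /andP[].
move=> x ax; move: x ax; apply: encP => [x /negP//|s u q hu hq _].
rewrite active_enc // lo_enc // partner_enc //= addn0 hu subn0.
by case: s => /= h; rewrite active_enc // lo_enc.
Qed.

Lemma partner0_enc s u q : u < L -> q < K ->
  partner P 0 (enc s u q) = enc (~~ s) u q.
Proof. by move=> hu hq; rewrite partner_enc // subn0 addn0 hu; case: s. Qed.

End Coordinates.

(** * Rotation chains through unit shifts inside blocks *)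

Section Chains.
Local Open Scope ring_scope.
Local Open Scope complex_scope.
Variable R : realType.
Local Notation C := (R[i]).
Variables (n L K : nat).
Hypotheses (L_gt0 : (0 < L)%N) (K_gt0 : (0 < K)%N) (Pn : (2 * (K * L) <= 2 ^ n)%N).
Local Notation P := (K * L)%N.
Local Notation lsh := (lsh L K).
Local Notation psi := (psi L K).
Local Notation hsh := (hsh L K).
Implicit Types (l : seq (bool -> bool -> R)) (Zf : nat -> nat -> bool).

(** Each rotation pairs the two samples of one position; the odd samples then move back by one
    inside their blocks, which sets up the next offset. *)
Fixpoint shift_rot_chain Zf t l : 'M[C]_(2 ^ n) :=
  if l is Q :: l' then shift_rot_chain Zf t.+1 l' *m (prm R n (lsh 1) *m rotmx n (Zf t) (partner P 0) Q)
  else 1%:M.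

Let modL u : (u %% L < L)%N. Proof. by rewrite ltn_mod. Qed.
Let modK q : (q %% K < K)%N. Proof. by rewrite ltn_mod. Qed.

Lemma lsh_lt t x : (x < 2 ^ n)%N -> (lsh t x < 2 ^ n)%N.
Proof. by apply: onodd_lt. Qed.

Lemma psi_lt x : (x < 2 ^ n)%N -> (psi x < 2 ^ n)%N.
Proof. by apply: onodd_lt. Qed.

Lemma hsh_lt x : (x < 2 ^ n)%N -> (hsh x < 2 ^ n)%N.
Proof. by apply: onodd_lt. Qed.

Lemma fixh_lt J x : (x < 2 ^ n)%N -> (fixh L K J x < 2 ^ n)%N.
Proof.
move=> hx; rewrite /fixh; case: ifP => // _.
by apply: leq_trans Pn; apply: (active_enc L_gt0 K_gt0 true); rewrite ?lo_lt.
Qed.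

Lemma iter_psi_lt k x : (x < 2 ^ n)%N -> (iter k psi x < 2 ^ n)%N.
Proof. by move=> hx; elim: k => //= k IH; apply: psi_lt. Qed.

(** [theta] is the relabelling made before the chain: [id] for the A part, [hsh] for the B part. *)
Lemma shift_rot_chainE Zf Zf' (theta : nat -> nat) t l :
  (forall x, (x < 2 ^ n)%N -> (theta x < 2 ^ n)%N) ->
  (forall t Q, (t < L)%N ->
    prm R n (lsh t \o theta) *m rotmx n (Zf t) (partner P t) Q =
    rotmx n (Zf' t) (partner P 0) Q *m prm R n (lsh t \o theta)) ->
  (t + size l <= L)%N ->
  shift_rot_chain Zf' t l *m prm R n (lsh t \o theta) =
    prm R n (lsh (t + size l) \o theta) *m rot_chain n P Zf t l.
Proof.
move=> th hint; elim: l t => [|Q l IH] t; first by rewrite addn0 mulmx1 mul1mx.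
rewrite [size _]/= addnS => h; rewrite [rot_chain _ _ _ _ _]/= [shift_rot_chain _ _ _]/=.
rewrite [RHS]mulmxA -addSn -IH; last by rewrite addSn.
rewrite -!mulmxA -hint; last by lia.
congr (_ *m _); rewrite mulmxA prm_mul; last by move=> x hx; apply: lsh_lt; apply: th.
congr (_ *m _); apply: eq_prm => x hx /=; rewrite lshS //; lia.
Qed.

Lemma lsh_inj t x y : (t <= L)%N -> lsh t x = lsh t y -> x = y.
Proof. by move=> ht e; rewrite -(iter_psi_lsh L_gt0 K_gt0 x ht) e iter_psi_lsh. Qed.

Lemma intertwineA t Q : (t < L)%N ->
  prm R n (lsh t \o id) *m rotmx n (inA L K t) (partner P t) Q =
  rotmx n (condA L K t) (partner P 0) Q *m prm R n (lsh t \o id).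
Proof.
move=> ht; apply: rot_intertwine => /=.
- by move=> x; apply: lsh_lt.
- by move=> x y _ _; apply: lsh_inj; apply: ltnW.
- move=> x _; move: x; apply: (encP L_gt0 K_gt0) => [x ax|s u q hu hq].
    by rewrite /lsh onodd_out // /condA /inA (negPf ax).
  rewrite /lsh (onodd_enc L_gt0 K_gt0) //; case: s; rewrite inA_enc //; last by rewrite condA_enc.
  rewrite condA_enc //; case: (leqP t u) => h.
    by rewrite (_ : u + (L - t) = (u - t) + L)%N ?modnDr ?modn_small; lia.
  by rewrite modn_small; lia.
- by move=> x _; rewrite odd_onodd.
move=> x _; move: x; apply: (encP L_gt0 K_gt0) => [x ax|s u q hu hq].
  by rewrite /inA (negPf ax).
have Pg : (0 < P)%N by rewrite muln_gt0 K_gt0.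
move=> h; split.
  by apply: leq_trans Pn; apply: partner_lt => //; apply: leLP => //; apply: ltnW.
move: h; rewrite inA_enc // /lsh (onodd_enc L_gt0 K_gt0) // (partner_enc L_gt0 K_gt0 _ (ltnW ht) hu hq).
case: s => h; rewrite h.
  rewrite (_ : u + (L - t) = (u - t) + L)%N ?modnDr ?modn_small; try lia.
  by rewrite partner0_enc // ?(onodd_enc L_gt0 K_gt0) //; lia.
rewrite partner0_enc // (onodd_enc L_gt0 K_gt0) //; congr enc.
by rewrite (_ : u + t + (L - t) = u + L)%N ?modnDr ?modn_small //; lia.
Qed.

(** [hsh] brings the odd partner from the next block into the block of the even sample, and [lsh t]
    brings it to the same position. *)
Lemma intertwineB t Q : (t < L)%N ->
  prm R n (lsh t \o hsh) *m rotmx n (inB L K t) (partner P t) Q =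
  rotmx n (condB L K t) (partner P 0) Q *m prm R n (lsh t \o hsh).
Proof.
move=> ht; apply: rot_intertwine => /=.
- by move=> x hx; apply/lsh_lt/hsh_lt.
- move=> x y _ _ /lsh_inj e; rewrite -(hshK L_gt0 K_gt0 x) e ?hshK //; exact: ltnW.
- move=> x _; move: x; apply: (encP L_gt0 K_gt0) => [x ax|s u q hu hq].
    by rewrite /lsh /hsh !onodd_out // /condB /inB (negPf ax).
  rewrite /lsh /hsh (onodd_enc L_gt0 K_gt0) //; case: s; rewrite (onodd_enc L_gt0 K_gt0) // inB_enc //;
    last by rewrite condB_enc.
  rewrite condB_enc //; case: (leqP t u) => h.
    by rewrite (_ : u + (L - t) = (u - t) + L)%N ?modnDr ?modn_small; lia.
  by rewrite modn_small; lia.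
- by move=> x _; rewrite !odd_onodd.
move=> x _; move: x; apply: (encP L_gt0 K_gt0) => [x ax|s u q hu hq].
  by rewrite /inB (negPf ax).
have Pg : (0 < P)%N by rewrite muln_gt0 K_gt0.
move=> h; split.
  by apply: leq_trans Pn; apply: partner_lt => //; apply: leLP => //; apply: ltnW.
move: h; rewrite inB_enc // /lsh /hsh (onodd_enc L_gt0 K_gt0) // (partner_enc L_gt0 K_gt0 _ (ltnW ht) hu hq).
case: s => h.
  have l1 : (u + L - t < L)%N by lia.
  have e : (u + (L - t) = u + L - t)%N by lia.
  rewrite leqNgt h /= (onodd_enc L_gt0 K_gt0) // e modn_small //.
  by rewrite partner0_enc // !(onodd_enc L_gt0 K_gt0).
have l1 : (u + t - L < L)%N by lia.
rewrite ltnNge h /= !(onodd_enc L_gt0 K_gt0) //.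
rewrite partner0_enc //; congr enc.
  by rewrite (_ : u + t - L + (L - t) = u)%N ?modn_small //; lia.
by rewrite modnDml -addnA subnKC // modnDr modn_small.
Qed.

Let gB t (Q : bool -> bool -> R) := rotmx n (inB L K t) (partner P t) Q.

Lemma rot_chainA_comm t0 t l Q : (t0 < t)%N -> (t + size l <= L)%N ->
  rot_chain n P (inA L K) t l *m gB t0 Q = gB t0 Q *m rot_chain n P (inA L K) t l.
Proof.
elim: l t => [|Q' l IH] t h0 h; first by rewrite mulmx1 mul1mx.
move: h; rewrite [size _]/= addnS => h.
have pA := fun h => pairing_inA L_gt0 K_gt0 Pn (h : t <= L)%N.
rewrite [rot_chain _ _ _ _ _]/= -mulmxA -[X in _ *m X]rot_comm; last 3 first.
- by apply: pairing_inB => //; lia.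
- by apply: pA; lia.
- by move=> x _; apply: inAB_disj => //; apply: ltnW.
by rewrite mulmxA IH ?mulmxA //; lia.
Qed.

Lemma rot_chain_split t l : (t + size l <= L)%N ->
  rot_chain n P (fun=> active P) t l = rot_chain n P (inB L K) t l *m rot_chain n P (inA L K) t l.
Proof.
elim: l t => [|Q l IH] t; first by rewrite mul1mx.
rewrite [size _]/= addnS => h; rewrite [LHS]/= IH; last by lia.
rewrite (@rot_split R n _ (inB L K t) (inA L K t)); last 4 first.
- by apply: pairing_inB => //; lia.
- by apply: pairing_inA => //; lia.
- by move=> x _; apply: inAB_disj.
- by move=> x _; rewrite active_split.
rewrite -[in LHS]mulmxA [X in _ *m X = _]mulmxA -/(gB t Q) rot_chainA_comm //.
by rewrite /= !mulmxA.
Qed.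

Lemma rot_chainA_shift l : (size l <= L)%N ->
  rot_chain n P (inA L K) 0 l = prm R n (iter (size l) psi) *m shift_rot_chain (condA L K) 0 l.
Proof.
move=> h; have := @shift_rot_chainE (inA L K) (condA L K) id 0 l (fun x hx => hx) intertwineA h.
have -> : prm R n (lsh 0 \o id) = 1%:M.
  by rewrite -prm_id; apply: eq_prm => x _ /=; rewrite lsh0.
rewrite mulmx1 => ->; rewrite mulmxA prm_mul; last by move=> x hx; apply: lsh_lt.
rewrite (_ : prm R n _ = 1%:M) ?mul1mx // -prm_id; apply: eq_prm => x _ /=.
exact: iter_psi_lsh.
Qed.

(** After the B part the odd samples are off by [J.+1] inside their block and by one block. One
    [psi] reduces the former to [J]; up to [fixh], the rest is the shift contained in [rbf P J]. *)
Lemma rbf_rot_chain J l : size l = J.+1 -> (J < L)%N ->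
  prm R n (rbf P J) *m rot_chain n P (fun=> active P) 0 l =
  prm R n (rbf P 0) *m (prm R n (fixh L K J) *m ((prm R n psi *m shift_rot_chain (condB L K) 0 l) *m
   (prm R n hsh *m (prm R n (iter J.+1 psi) *m shift_rot_chain (condA L K) 0 l)))).
Proof.
move=> sl hJ; have hl : (size l <= L)%N by rewrite sl.
rewrite (@rot_chain_split 0 l hl) (rot_chainA_shift hl) sl !mulmxA.
congr (_ *m _); congr (_ *m _).
have := @shift_rot_chainE (inB L K) (condB L K) hsh 0 l hsh_lt intertwineB; rewrite sl => /(_ hJ).
have -> : prm R n (lsh 0 \o hsh) = prm R n hsh.
  by apply: eq_prm => x _ /=; rewrite lsh0.
move=> e0; rewrite -[RHS]mulmxA e0 !mulmxA; congr (_ *m _).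
have f3 x : (x < 2 ^ n)%N -> ((lsh (0 + J.+1) \o hsh) x < 2 ^ n)%N.
  by move=> hx; apply/lsh_lt/hsh_lt.
rewrite (prm_mul _ _ (@fixh_lt J)) (prm_mul _ _ psi_lt) (prm_mul _ _ f3).
apply: eq_prm => x hx /=; rewrite psi_lshS // rbf_fixh //.
Qed.

(** Offset [0] never leaves a block. The case is kept apart because for [L = 1] no ancilla would be
    free for [fixh]. *)
Lemma rbf_rot_chain0 l : size l = 1%N ->
  prm R n (rbf P 0) *m rot_chain n P (fun=> active P) 0 l =
  prm R n (rbf P 0) *m (prm R n (iter 1 psi) *m shift_rot_chain (condA L K) 0 l).
Proof.
move=> sl; have hl : (size l <= L)%N by rewrite sl.
rewrite (@rot_chain_split 0 l hl) (rot_chainA_shift hl) sl.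
have -> : rot_chain n P (inB L K) 0 l = 1%:M; last by rewrite mul1mx.
case: l sl {hl} => [|Q [|]] //= _; rewrite mul1mx; apply: rot_pred0 => x _.
rewrite /inB; case: active => //=; rewrite addn0; case: odd => //.
by have := lo_lt L_gt0 x; lia.
Qed.

End Chains.

Lemma upd_same s q b : s q = b -> upd s q b = s.
Proof. by move=> <-; exact: upd_id. Qed.

Lemma setb_upd s q b qs v : q \notin qs -> setb (upd s q b) qs v = upd (setb s qs v) q b.
Proof.
move=> h; apply/funext => j; rewrite /setb !updE; case: (altP (j =P q)) => [->|] //.
by rewrite (negPf h).
Qed.

Lemma bval_zero s qs : {in qs, s =1 xpred0} -> bval s qs = 0.
Proof.
elim: qs => //= q qs IH h; rewrite h ?mem_head //= IH ?muln0 // => j hj.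
by apply: h; rewrite inE hj orbT.
Qed.

Lemma disj_iota a k b j : (b + j <= a) || (a + k <= b) ->
  ~~ has (mem (iota a k)) (iota b j).
Proof. by move=> h; apply/hasPn => x; rewrite /= !mem_iota; lia. Qed.

Ltac uio := unorm; rewrite ?mem_iota ?iota_uniq; repeat (apply/andP; split); try done;
  try (by apply: disj_iota; lia); try lia.
Ltac onN := let j := fresh "j" in move=> j; unorm; rewrite ?mem_iota; lia.

(** * Circuits for one level *)

(* Data qubits [0 .. n - 1]: qubit 0 is the parity, [low] and [high] the position
   inside a block and the block number, [top] must vanish for the level to act.
   Ancillas: [f] holds that condition, [r] is a scratch bit, [c] a clean carry
   and [gs] receives constants. *)
Section Gadgets.
Variables n m l : nat.
Hypotheses (lm : l < m) (mn : m <= n).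
Local Notation k := (m - 1 - l).
Local Notation L := (2 ^ l).
Local Notation K := (2 ^ k).
Local Notation P := (K * L).
Local Notation f := n.
Local Notation r := n.+1.
Local Notation c := n.+2.
Local Notation gs := (iota n.+3 l).
Local Notation low := (iota 1 l).
Local Notation high := (iota l.+1 k).
Local Notation top := (iota m (n - m)).

Lemma powP : 2 * P = 2 ^ m.
Proof. by rewrite -expnD -expnS; congr (_ ^ _); lia. Qed.

Let L_gt0 : 0 < L. Proof. by rewrite expn_gt0. Qed.
Let K_gt0 : 0 < K. Proof. by rewrite expn_gt0. Qed.

Lemma powPn : 2 * P <= 2 ^ n.
Proof. by rewrite powP leq_exp2l. Qed.

(** For [x < 2 ^ n], every ancilla other than the flag is clean. *)
Definition fl (b : bool) (x : nat) : state := upd (qbit x) f b.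

Lemma fl_qbit b x q : q != f -> fl b x q = qbit x q.
Proof. by rewrite /fl updE => /negPf ->. Qed.

Lemma flf b x : fl b x f = b.
Proof. by rewrite /fl updE eqxx. Qed.

Lemma fl_anc b x q : x < 2 ^ n -> f < q -> fl b x q = false.
Proof.
by move=> hx hq; rewrite fl_qbit ?(qbit_small hx) //; [apply: ltnW | rewrite gtn_eqF].
Qed.

Lemma bval_fl b x a j : a + j <= n -> bval (fl b x) (iota a j) = (x %/ 2 ^ a) %% 2 ^ j.
Proof. by move=> h; rewrite /fl bval_upd ?bval_iota // mem_iota; lia. Qed.

Lemma setb_fl b x a j v : a + j <= n -> setb (fl b x) (iota a j) v = fl b (setf a j v x).
Proof. by move=> h; rewrite /fl setb_upd ?setb_iota // mem_iota; lia. Qed.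

Lemma setf_low v x : setf 1 l v x = enc L (odd x) (v %% L) (hi L x).
Proof. by rewrite /setf expn1 modn2 /enc /hi expnD divnMA divn2. Qed.

Lemma setf_high v x : active P x -> setf l.+1 k v x = enc L (odd x) (lo L x) (v %% K).
Proof.
rewrite /active powP => ax; rewrite /setf divn_small ?muln0 ?addn0; last first.
  by apply: leq_trans ax _; rewrite leq_exp2l //; lia.
rewrite -[x %% _]bit_half odd_modX half_modX /enc /lo expnS; ring.
Qed.

Lemma lo_bval b x : bval (fl b x) low = lo L x.
Proof. by rewrite bval_fl ?expn1 ?divn2 //; lia. Qed.

Lemma hi_bval b x : bval (fl b x) high = hi L x %% K.
Proof. by rewrite bval_fl ?expnS ?divnMA ?divn2 //; lia. Qed.

Lemma gs_zero b x : x < 2 ^ n -> {in gs, fl b x =1 xpred0}.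
Proof. by move=> hx q; rewrite mem_iota => hq; rewrite fl_anc //; lia. Qed.

(** The flag is recomputed from the data when it is cleared, so the maps run in between must keep
    it: [rbf] keeps activity but not parity, hence runs under [sA]. *)
Definition sA (x : nat) : state := fl (active P x) x.
Definition sO (x : nat) : state := fl (active P x && odd x) x.

Lemma active_onodd g h x : (forall u, u < L -> g u < L) -> (forall q, q < K -> h q < K) ->
  active P (onodd L K g h x) = active P x.
Proof.
move=> hg hh; rewrite /onodd; case: ifP => // /andP[ax _]; rewrite ax.
by apply: (active_enc L_gt0 K_gt0); [apply/hg/lo_lt | apply/hh/(hi_lt L_gt0 K_gt0)].
Qed.

Let modL u : u %% L < L. Proof. by rewrite ltn_mod. Qed.
Let modK q : q %% K < K. Proof. by rewrite ltn_mod. Qed.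

(** The adder serves as an incrementer: its summand [gs] is zero and the control enters as the
    carry-in [r]. *)
Definition cpsi : seq cgate := [:: TT 0 f r] ++ adder r gs low ++ [:: TT 0 f r].

Lemma cpsi_on : all (gate_on (iota 0 (n + l + 3))) cpsi.
Proof.
have u : uniq (r :: gs ++ low) by uio.
have h : gate_on (iota 0 (n + l + 3)) (TT 0 f r).
  by rewrite /gate_on /= !inE !mem_iota; lia.
rewrite /cpsi !all_cat !all_seq1 h andbT /=.
by apply: gate_on_sub (adder_on u); onN.
Qed.

Lemma cpsiE x : x < 2 ^ n -> evals cpsi (sA x) = sA (psi L K x).
Proof.
move=> hx; have u : uniq (r :: gs ++ low) by uio.
rewrite /cpsi !evals_cat [evals [:: _] (sA x)]/= adderE ?size_iota //.
rewrite /sA flf (@fl_anc (active P x) x r hx (ltnSn _)) addbF fl_qbit; last by lia.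
rewrite qbit0; set b := odd x && _.
have rg : r \notin gs by rewrite mem_iota; lia.
have rl : r \notin low by rewrite mem_iota; lia.
rewrite (bval_upd _ _ rg) (bval_upd _ _ rl).
rewrite (bval_zero (gs_zero _ hx)) lo_bval add0n [upd _ r b r]updE eqxx.
set s2 := setb _ _ _.
have nlow q : (q == 0) || (n <= q) -> s2 q = if q == r then b else fl (active P x) x q.
  by move=> hq; rewrite /s2 setb_out ?updE // mem_iota; lia.
rewrite /= (nlow 0) // (nlow f) ?leqnn ?orbT // (nlow r) ?leqnSn ?orbT //.
rewrite eqxx flf !ifF; try lia.
rewrite qbit0 -/b addbb /s2 setb_upd ?mem_iota; last by lia.
rewrite upd_upd upd_same; last by rewrite setb_out ?fl_anc // mem_iota; lia.
rewrite setb_fl; last by lia.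
have -> : active P (psi L K x) = active P x by apply: active_onodd.
congr fl; rewrite setf_low /psi /onodd andbC -/b.
case eb: b; last by rewrite addn0 modn_small ?lo_lt // enc_dec.
by move: eb => /andP[-> _].
Qed.

Lemma clshE x : x < 2 ^ n -> evals (rev cpsi) (sA x) = sA (lsh L K 1 x).
Proof.
move=> hx; apply: evals_rev cpsi_on _; rewrite cpsiE ?psi_lshS ?lsh0 //.
by apply: lsh_lt => //; exact: powPn.
Qed.

Definition ccmp (t : nat) : seq cgate := cmp f c gs low t r.

Lemma ccmp_on t : all (gate_on (iota 0 (n + l + 3))) (ccmp t).
Proof.
have u : uniq (r :: f :: c :: gs ++ low) by uio.
by apply: gate_on_sub (cmp_on t u _); [onN | rewrite !size_iota].
Qed.

Lemma ccmpE t b x : t < L -> x < 2 ^ n ->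
  evals (ccmp t) (fl b x) = upd (fl b x) r (b && (L <= lo L x + t)).
Proof.
move=> ht hx; have u : uniq (r :: f :: c :: gs ++ low) by uio.
have c0 : fl b x c = false by rewrite fl_anc.
have r0 : fl b x r = false by rewrite fl_anc.
rewrite /ccmp cmpE ?size_iota //; last exact: gs_zero.
by rewrite flf r0 addbF lo_bval addnC.
Qed.

(** Negates the comparison only where [f] is set. *)
Definition ccmpN (t : nat) : seq cgate := ccmp t ++ [:: TC f r].

Lemma ccmpN_on t : all (gate_on (iota 0 (n + l + 3))) (ccmpN t).
Proof.
rewrite /ccmpN all_cat ccmp_on all_seq1 /gate_on /= !inE !mem_iota; lia.
Qed.

Lemma ccmpNE t b x : t < L -> x < 2 ^ n ->
  evals (ccmpN t) (fl b x) = upd (fl b x) r (b && (lo L x + t < L)).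
Proof.
move=> ht hx; rewrite evals_cat ccmpE // [evals _ _]/= !updE eqxx upd_upd.
rewrite (_ : (f == r) = false) ?flf; last by lia.
by congr upd; case: b => //=; rewrite ltnNge.
Qed.

Lemma qbit_enc0 s u q : qbit (enc L (~~ s) u q) = upd (qbit (enc L s u q)) 0 (~~ s).
Proof.
apply/funext => -[|j]; rewrite updE ?qbit0 ?odd_enc //=.
by rewrite !qbitS !half_enc.
Qed.

Lemma fl_partner0 x b : active P x -> fl b (partner P 0 x) = upd (fl b x) 0 (~~ odd x).
Proof.
move=> ax; rewrite -(enc_dec L x) partner0_enc ?lo_lt ?(hi_lt L_gt0 K_gt0) //.
rewrite odd_enc /fl qbit_enc0; apply/funext => j; rewrite !updE.
by case: (altP (j =P f)) => [->|] //; rewrite ifF //; lia.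
Qed.

Lemma partner0_inv x : active P x ->
  active P (partner P 0 x) /\ lo L (partner P 0 x) = lo L x.
Proof.
move=> ax; have hu := lo_lt L_gt0 x; have hq := hi_lt L_gt0 K_gt0 ax.
by rewrite -(enc_dec L x) partner0_enc // !lo_enc // active_enc.
Qed.

Definition chsh : seq cgate := binc f c r 0 high.

Lemma chsh_on : all (gate_on (iota 0 (n + l + 3))) chsh.
Proof.
have u : uniq (f :: c :: r :: 0 :: high) by uio.
by apply: gate_on_sub (binc_on u); onN.
Qed.

Lemma chshiE x : x < 2 ^ n -> evals chsh (sO x) = sO (hshi L K x).
Proof.
move=> hx; have u : uniq (f :: c :: r :: 0 :: high) by uio.
have c0 b : fl b x c = false by rewrite fl_anc.
have r0 b : fl b x r = false by rewrite fl_anc.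
rewrite /chsh /sO bincE // flf hi_bval.
rewrite /hshi /onodd; case: ifP => [/andP[ax ox]|eb]; last first.
  by rewrite addn0 -[_ %% _](hi_bval false) setb_bval eb.
rewrite setb_fl; last by lia.
by rewrite setf_high // ox modnDml active_enc ?lo_lt // ?ltn_mod // odd_enc.
Qed.

Lemma chshE x : x < 2 ^ n -> evals (rev chsh) (sO x) = sO (hsh L K x).
Proof.
move=> hx; apply: evals_rev chsh_on _; rewrite chshiE ?hshK //.
by apply: hsh_lt => //; exact: powPn.
Qed.

Definition sF (J x : nat) : state :=
  upd (sO x) r ((active P x && odd x) && (lo L x + J < L)).

(** With [r] as the control, the first qubit of [gs] takes over as a clean qubit; it exists only for
    [0 < l]. *)
Definition cfix : seq cgate := binc r c n.+3 0 high.

Lemma cfix_on : 0 < l -> all (gate_on (iota 0 (n + l + 3))) cfix.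
Proof.
move=> l0; have u : uniq (r :: c :: n.+3 :: 0 :: high) by uio.
by apply: gate_on_sub (binc_on u); onN.
Qed.

(** The control depends on activity, parity and [lo], none of which [fixh] changes, so it can be
    uncomputed afterwards. *)
Lemma cfixE J x : 0 < l -> x < 2 ^ n -> evals cfix (sF J x) = sF J (fixh L K J x).
Proof.
move=> l0 hx; have u : uniq (r :: c :: n.+3 :: 0 :: high) by uio.
have anc q : r < q -> sF J x q = false.
  by move=> hq; rewrite /sF /sO updE ifF ?fl_anc //; lia.
have ac : sF J x c = false by exact: anc.
have aw : sF J x n.+3 = false by apply: anc; lia.
rewrite /cfix bincE // /sF [upd _ _ _ r]updE.
rewrite eqxx bval_upd ?mem_iota; last by lia.
rewrite setb_upd ?mem_iota; last by lia.
rewrite /sO hi_bval /fixh -andbA; case: ifP => [/and3P[ax ox hl]|eb]; last first.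
  by rewrite addn0 -[_ %% _](hi_bval (active P x && odd x)) setb_bval -andbA eb.
rewrite setb_fl; last by lia.
by rewrite setf_high // ox modnDml active_enc ?lo_lt // ?ltn_mod // lo_enc ?lo_lt // odd_enc hl ax.
Qed.

(** For offset [0] the closing permutation is the bit rotation that makes the parity the top one of
    [m] bits. *)
Definition crb : seq cgate := crot f 0 (iota 1 m.-1).

Lemma crb_on : all (gate_on (iota 0 (n + l + 3))) crb.
Proof.
have u : uniq (f :: 0 :: iota 1 m.-1) by uio.
by apply: gate_on_sub (crot_on u); onN.
Qed.

Lemma crbE x : x < 2 ^ n -> evals crb (sA x) = sA (rbf P 0 x).
Proof.
move=> hx; have u : uniq (f :: 0 :: iota 1 m.-1) by uio.
rewrite /crb crotE // /sA flf /rbf -/(active P x); case: ifP => ax; last by rewrite ax.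
have m0 : m = m.-1.+1 by lia.
have eP : P = 2 ^ m.-1 by rewrite -expnD; congr (_ ^ _); lia.
have hx2 : x./2 < P by move: ax; rewrite /active; lia.
rewrite (_ : 0 :: iota 1 m.-1 = iota 0 m); last by rewrite [in RHS]m0.
rewrite setb_fl // bval_fl; last by lia.
rewrite fl_qbit; last by lia.
rewrite size_iota qbit0 expn1 divn2 -eP modn_small // subn0 modnDr modn_small //.
have -> : setf 0 m (x./2 + P * odd x) x = x./2 + P * odd x.
  rewrite /setf expn0 modn1 add0n mul1n add0n -powP divn_small // muln0 addn0.
  by rewrite modn_small //; case: odd; lia.
have -> : (if odd x then P + x./2 else x./2) = x./2 + P * odd x.
  by case: odd; rewrite ?muln1 ?muln0 ?addn0 // addnC.
by congr fl; rewrite /active; case: odd; lia.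
Qed.

Lemma top_zero x : x < 2 ^ n -> all (fun q => ~~ qbit x q) top = active P x.
Proof.
move=> hx; rewrite /active powP; apply/allP/idP => [h|h q]; last first.
  by rewrite mem_iota => hq; rewrite (qbit_small h) //; lia.
have : x %/ 2 ^ m = 0.
  apply: (@qbit_inj _ _ (n - m)); rewrite ?expn_gt0 //.
    by rewrite ltn_divLR ?expn_gt0 // -expnD subnK.
  move=> j hj; rewrite qbit_zero /qbit -divnMA -expnD.
  by apply: negbTE; apply: h; rewrite mem_iota; lia.
by move=> e; rewrite -[2 ^ m]mul1n -ltn_divLR ?expn_gt0 // e.
Qed.

Definition cflag (e z : nat) (T : seq nat) : seq cgate :=
  nots top ++ flag e c r z T f ++ rev (nots top).

Lemma cflag_on e z T : uniq (e :: c :: r :: z :: T ++ [:: f]) ->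
  all (fun q => q < n) (e :: z :: T) -> all (gate_on (iota 0 (n + l + 3))) (cflag e z T).
Proof.
move=> u /= /and3P[he hz /allP hT].
have ht : all (gate_on (iota 0 (n + l + 3))) (nots top) by apply: gate_on_sub (nots_on top); onN.
rewrite /cflag all_cat ht all_cat all_rev ht andbT /=.
apply: gate_on_sub (flag_on u) => j; unorm; rewrite !mem_iota.
by case/or4P => [||| /or3P[|/hT|]]; lia.
Qed.

Lemma cflagE e z T x : uniq (e :: c :: r :: z :: T ++ [:: f]) -> x < 2 ^ n ->
  evals (cflag e z T) (qbit x) =
    fl (evals (nots top) (qbit x) e && all (evals (nots top) (qbit x)) T) x.
Proof.
move=> u hx; have anc q : n <= q -> evals (nots top) (qbit x) q = false.
  move=> hq; rewrite (evals_out _ (nots_on top)) ?(qbit_small hx) //.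
  by rewrite mem_iota; lia.
have ftop : f \notin top by rewrite mem_iota; lia.
have ct : all (gate_on top) (rev (nots top)) by rewrite all_rev nots_on.
have ac := anc c (leqW (leqnSn _)); have ar := anc r (leqnSn _).
rewrite /cflag evals_cat evals_cat flagE // (anc f) //.
by rewrite addbF (evals_upd _ _ ct ftop) (evals_revK _ (nots_on top)).
Qed.

(** [flag] needs a control outside its list: the lowest qubit of [top] serves, and for empty [top]
    the flag is constantly set. *)
Definition cflA : seq cgate :=
  if n == m then [:: TX f] else cflag m 0 (iota m.+1 (n - m.+1)).

Lemma cflA_on : all (gate_on (iota 0 (n + l + 3))) cflA.
Proof.
rewrite /cflA; case: eqP => e; first by rewrite all_seq1; apply: gate_on_TX; rewrite mem_iota; lia.
apply: cflag_on; first by uio.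
by rewrite /= ; apply/and3P; split; [lia | lia | apply/allP => q; rewrite mem_iota; lia].
Qed.

Lemma cflAE x : x < 2 ^ n -> evals cflA (qbit x) = sA x.
Proof.
move=> hx; rewrite /cflA /sA; case: eqP => e.
  rewrite /= (qbit_small hx) // (_ : active P x) //.
  by rewrite /active powP -e.
rewrite cflagE //; last by uio.
rewrite -[_ && _]/(all (evals (nots top) (qbit x)) (m :: iota m.+1 (n - m.+1))).
have -> : m :: iota m.+1 (n - m.+1) = top.
  by have -> : n - m = (n - m.+1).+1 by lia.
congr fl; rewrite -top_zero //; apply: eq_in_all => q hq.
by rewrite notsE ?iota_uniq // hq addTb.
Qed.

(** The parity qubit is the control and qubit 1 is borrowed; [1 < m] keeps it outside [top]. *)
Definition cflO : seq cgate := cflag 0 1 top.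

Lemma cflO_on : 1 < m -> all (gate_on (iota 0 (n + l + 3))) cflO.
Proof.
move=> m1; apply: cflag_on; first by uio.
by rewrite /= ; apply/and3P; split; [lia | lia | apply/allP => q; rewrite mem_iota; lia].
Qed.

Lemma cflOE x : 1 < m -> x < 2 ^ n -> evals cflO (qbit x) = sO x.
Proof.
move=> m1 hx; rewrite /cflO cflagE //; last by uio.
congr fl; rewrite andbC; congr (_ && _).
  rewrite -top_zero //; apply: eq_in_all => q hq.
  by rewrite notsE ?iota_uniq // hq addTb.
by rewrite notsE ?iota_uniq // mem_iota (_ : (m <= 0) = false) ?qbit0 //; lia.
Qed.

(** * Gate counts of the gadgets *)

Lemma size_cpsi : size cpsi <= 6 * l + 2.
Proof. by rewrite !size_cat /=; have := size_adder r gs low; rewrite size_iota; lia. Qed.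

Lemma size_ccmpN t : size (ccmpN t) <= 8 * l + 2.
Proof. by rewrite size_cat /=; have := size_cmp f c gs low t r; rewrite size_iota /ccmp; lia. Qed.

Lemma size_cflag e z T : size (cflag e z T) <= 168 * size T + 2 * n + 220.
Proof.
rewrite /cflag size_cat size_cat size_rev size_map size_iota; have := size_flag e c r z T f; lia.
Qed.

Lemma size_cflA : size cflA <= 170 * n + 220.
Proof.
rewrite /cflA; case: eqP => e /=; first by lia.
by apply: leq_trans (size_cflag _ _ _) _; rewrite size_iota; lia.
Qed.

Lemma size_cflO : size cflO <= 170 * n + 220.
Proof. by apply: leq_trans (size_cflag _ _ _) _; rewrite size_iota; lia. Qed.

Lemma size_chsh : size chsh <= 84 * n + 68.
Proof. by apply: leq_trans (size_binc _ _ _ _ _) _; rewrite size_iota; lia. Qed.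

Lemma size_cfix : size cfix <= 84 * n + 68.
Proof. by apply: leq_trans (size_binc _ _ _ _ _) _; rewrite size_iota; lia. Qed.

Lemma size_crb : size crb <= 3 * n.
Proof. by rewrite size_crot size_iota; lia. Qed.

End Gadgets.

(** * One level assembled from the gadgets *)

Section Level.
Local Open Scope ring_scope.
Local Open Scope complex_scope.
Variable R : realType.
Local Notation C := (R[i]).
Variables N n m l : nat.
Hypotheses (lm : (l < m)%N) (mn : (m <= n)%N) (nN : (n + l + 3 <= N)%N).
Local Notation L := (2 ^ l)%N.
Local Notation K := (2 ^ (m - 1 - l))%N.
Local Notation P := (K * L)%N.
Local Notation SA := (sA n m l).
Local Notation SO := (sO n m l).
Local Notation SF := (sF n m l).
Implicit Types (ls : seq (bool -> bool -> R)) (Q : bool -> bool -> R).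

Let L_gt0 : (0 < L)%N. Proof. by rewrite expn_gt0. Qed.
Let K_gt0 : (0 < K)%N. Proof. by rewrite expn_gt0. Qed.
Let Pn := powPn lm mn.

Lemma gate_on_leq cs : all (gate_on (iota 0 (n + l + 3))) cs -> all (gate_on (iota 0 N)) cs.
Proof. by apply: gate_on_sub => j; rewrite !mem_iota; lia. Qed.

(** Compute, act, uncompute. The action ends in states of the form [S'] again, so the reversed
    circuit finds ancillas that match the new data. *)
Lemma impl_conj S S' cs b k (W : 'M[C]_(2 ^ n)) : all (gate_on (iota 0 (n + l + 3))) cs ->
  (forall x, (x < 2 ^ n)%N -> evals cs (S x) = S' x) -> (size cs <= b)%N ->
  impl N S' S' k W -> impl N S S (2 * b + k) W.
Proof.
move=> cc h hb iW.
have i1 : impl N S S' (size cs) (1%:M : 'M[C]_(2 ^ n)) by apply: impl_id => //; apply: gate_on_leq.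
have i2 : impl N S' S (size cs) (1%:M : 'M[C]_(2 ^ n)).
  rewrite -size_rev; apply: impl_id; first by rewrite all_rev; apply: gate_on_leq.
  by move=> x hx; apply: evals_rev cc _; apply: h.
have := impl_mul (impl_mul i1 iW) i2; rewrite mul1mx mulmx1; apply: impl_leq; lia.
Qed.

Lemma impl_cond cs (p : nat -> bool) Q : orth Q ->
  all (gate_on (iota 0 (n + l + 3))) cs -> (size cs <= 8 * l + 2)%N ->
  (forall x, (x < 2 ^ n)%N -> evals cs (SA x) = upd (SA x) n.+1 (active P x && p (lo L x))) ->
  impl N SA SA (16 * l + 5) (rotmx n (fun x => active P x && p (lo L x)) (partner P 0) Q).
Proof.
move=> oQ cc hs h.
have -> : (16 * l + 5 = 2 * (8 * l + 2) + 1)%N by lia.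
apply: impl_conj cc h hs _.
apply: (@impl_rot R N n _ n.+1 0) => //; try lia.
- by apply: pairing_cond => //; exact: Pn.
- by move=> x hx; rewrite updE eqxx.
- move=> x hx; rewrite updE ifF; last by lia.
  exact: qbit0.
(* Both partners satisfy the same condition, so their states differ in qubit 0 only. *)
move=> x hx /andP[ax px]; have [pa pl] := partner0_inv ax.
rewrite pa pl /sA pa (fl_partner0 lm mn) // ax; apply/funext => j; rewrite !updE.
by case: (altP (j =P n.+1)) => [->|] //; rewrite ifF //; lia.
Qed.

Lemma impl_condA t Q : (t < L)%N -> orth Q ->
  impl N SA SA (16 * l + 5) (rotmx n (condA L K t) (partner P 0) Q).
Proof.
move=> ht oQ; apply: (@impl_cond (ccmpN n l t) (fun u => u + t < L)%N) => //.
- exact: (ccmpN_on lm mn).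
- exact: (size_ccmpN lm mn).
- by move=> x hx; rewrite (ccmpNE lm mn).
Qed.

Lemma impl_condB t Q : (t < L)%N -> orth Q ->
  impl N SA SA (16 * l + 5) (rotmx n (condB L K t) (partner P 0) Q).
Proof.
move=> ht oQ; apply: (@impl_cond (ccmp n l t) (fun u => L <= u + t)%N) => //.
- exact: (ccmp_on lm mn).
- by have := size_ccmpN lm mn t; rewrite size_cat; lia.
- by move=> x hx; rewrite (ccmpE lm mn).
Qed.

Lemma impl_psi : impl N SA SA (6 * l + 2) (prm R n (psi L K)).
Proof.
apply: impl_leq (size_cpsi lm mn) _; apply: impl_prm.
- by apply: gate_on_leq; apply: (cpsi_on lm mn).
- by move=> x; apply: psi_lt => //; exact: Pn.
- by move=> x hx; rewrite (cpsiE lm mn).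
Qed.

Lemma impl_lsh : impl N SA SA (6 * l + 2) (prm R n (lsh L K 1)).
Proof.
apply: impl_leq (size_cpsi lm mn) _; rewrite -size_rev; apply: impl_prm.
- by rewrite all_rev; apply: gate_on_leq; apply: (cpsi_on lm mn).
- by move=> x; apply: lsh_lt => //; exact: Pn.
- by move=> x hx; rewrite (clshE lm mn).
Qed.

Lemma impl_iter_psi j : impl N SA SA ((6 * l + 2) * j) (prm R n (iter j (psi L K))).
Proof.
elim: j => [|j IH].
  rewrite muln0 (@eq_prm _ _ _ id) // prm_id; exact: (@impl_id R N n _ _ [::]).
have := impl_mul IH impl_psi; rewrite prm_mul; last first.
  by move=> x; apply: iter_psi_lt => //; exact: Pn.
by rewrite mulnS addnC.
Qed.

Lemma impl_shift_rot_chain Zf t ls :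
  (forall t Q, (t < L)%N -> orth Q ->
    impl N SA SA (16 * l + 5) (rotmx n (Zf t) (partner P 0) Q)) ->
  (t + size ls <= L)%N -> orths ls ->
  impl N SA SA ((22 * l + 7) * size ls) (shift_rot_chain n L K Zf t ls).
Proof.
move=> hZ; elim: ls t => [|Q ls IH] t /=.
  by rewrite muln0 => _ _; exact: (@impl_id R N n _ _ [::]).
rewrite addnS => ht [oQ ols].
have ht' : (t < L)%N by lia.
have := impl_mul (impl_mul (hZ t Q ht' oQ) impl_lsh) (IH t.+1 ht ols).
by apply: impl_leq; rewrite mulnS; lia.
Qed.

Lemma impl_flA k (W : 'M[C]_(2 ^ n)) : impl N SA SA k W ->
  impl N qbit qbit (2 * (170 * n + 220) + k) W.
Proof.
apply: impl_conj; first exact: (cflA_on lm mn).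
  by move=> x hx; rewrite (cflAE lm mn).
exact: (size_cflA lm mn).
Qed.

Lemma impl_flO k (W : 'M[C]_(2 ^ n)) : (0 < l)%N -> impl N SO SO k W ->
  impl N qbit qbit (2 * (170 * n + 220) + k) W.
Proof.
move=> l0; have m1 : (1 < m)%N by lia.
apply: impl_conj; first exact: (cflO_on lm mn).
  by move=> x hx; rewrite (cflOE lm mn).
exact: (size_cflO lm mn).
Qed.

Lemma impl_hsh : impl N SO SO (84 * n + 68) (prm R n (hsh L K)).
Proof.
apply: impl_leq (size_chsh lm mn) _; rewrite -size_rev; apply: impl_prm.
- by rewrite all_rev; apply: gate_on_leq; apply: (chsh_on lm mn).
- by move=> x; apply: hsh_lt => //; exact: Pn.
- by move=> x hx; rewrite (chshE lm mn).
Qed.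

Lemma impl_fix J : (0 < l)%N -> (J < L)%N ->
  impl N SO SO (2 * (8 * l + 2) + (84 * n + 68)) (prm R n (fixh L K J)).
Proof.
move=> l0 hJ; apply: (@impl_conj SO (SF J) (ccmpN n l J)).
- exact: (ccmpN_on lm mn).
- by move=> x hx; rewrite (ccmpNE lm mn).
- exact: (size_ccmpN lm mn).
apply: impl_leq (size_cfix lm mn) _; apply: impl_prm.
- by apply: gate_on_leq; apply: (cfix_on lm mn).
- by move=> x; apply: fixh_lt => //; exact: Pn.
- by move=> x hx; rewrite (cfixE lm mn).
Qed.

Lemma impl_rb : impl N SA SA (3 * n) (prm R n (rbf P 0)).
Proof.
apply: impl_leq (size_crb lm mn) _; apply: impl_prm.
- by apply: gate_on_leq; apply: (crb_on lm mn).
- by move=> x; apply: rbf_lt; [rewrite muln_gt0 K_gt0 | exact: Pn].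
- by move=> x hx; rewrite (crbE lm mn).
Qed.

(** [n] is positive and absorbs the additive constants of the flag computations; [5000] is a round
    bound. *)
Lemma impl_level J ls : size ls = J.+1 -> (J < L)%N -> orths ls ->
  impl N qbit qbit (5000 * (n + l.+1 * J.+1))
    (prm R n (rbf P J) *m rot_chain n P (fun=> active P) 0 ls).
Proof.
move=> sl hJ ols.
have iA : impl N qbit qbit (2 * (170 * n + 220) + ((22 * l + 7) * J.+1 + (6 * l + 2) * J.+1))
    (prm R n (iter J.+1 (psi L K)) *m shift_rot_chain n L K (condA L K) 0 ls).
  apply: impl_flA; apply: impl_mul (impl_iter_psi _).
  by rewrite -sl; apply: impl_shift_rot_chain => //; [exact: impl_condA | rewrite sl].
have iR := impl_flA impl_rb.
case: J sl hJ iA => [|J] sl hJ iA.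
  rewrite (rbf_rot_chain0 L_gt0 K_gt0 Pn sl).
  by apply: impl_leq (impl_mul iA iR); nia.
have l0 : (0 < l)%N by move: hJ; case: (l).
have iH := impl_flO l0 impl_hsh.
have iF := impl_flO l0 (impl_fix l0 hJ).
have iB : impl N qbit qbit (2 * (170 * n + 220) + ((22 * l + 7) * J.+2 + (6 * l + 2)))
    (prm R n (psi L K) *m shift_rot_chain n L K (condB L K) 0 ls).
  apply: impl_flA; apply: impl_mul impl_psi.
  by rewrite -sl; apply: impl_shift_rot_chain => //; [exact: impl_condB | rewrite sl].
rewrite (rbf_rot_chain L_gt0 K_gt0 Pn sl hJ).
by apply: impl_leq (impl_mul (impl_mul (impl_mul (impl_mul iA iH) iB) iF) iR); nia.
Qed.

End Level.

(** * The wavelet filter in polyphase form *)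

Section Wavelet.
Local Open Scope ring_scope.
Local Open Scope complex_scope.
Variable R : realType.
Local Notation C := (R[i]).

Lemma sum_pairs (V : nmodType) j (F : nat -> V) :
  \sum_(i < 2 * j) F i = \sum_(i < j) (F (2 * i)%N + F (2 * i + 1)%N).
Proof.
elim: j => [|j IH]; first by rewrite muln0 !big_ord0.
rewrite (_ : 2 * j.+1 = (2 * j).+2)%N; last by lia.
by rewrite !big_ord_recr /= IH addrA addn1.
Qed.

Definition even_taps (J : nat) (h : nat -> R) (j : nat) : R := if (j <= J)%N then h (2 * j)%N else 0.
Definition odd_taps (J : nat) (h : nat -> R) (j : nat) : R := if (j <= J)%N then h (2 * j + 1)%N else 0.

(** A shift by [2 * k] keeps the parity of the tap index, so the correlation splits into even and
    odd taps. *)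
Lemma acorr_filter J h : wavelet_filter (2 * J.+1) h -> acorr J (even_taps J h) (odd_taps J h).
Proof.
case=> _ hk k; rewrite -hk.
rewrite (sum_pairs _ (fun i => if (i + 2 * k < 2 * J.+1)%N then h i * h (i + 2 * k)%N else 0)).
apply: eq_bigr => j _; have hj : (j <= J)%N by rewrite -ltnS.
rewrite /even_taps /odd_taps hj (_ : (2 * j + 2 * k < 2 * J.+1)%N = (j + k <= J)%N); last by lia.
rewrite (_ : (2 * j + 1 + 2 * k < 2 * J.+1)%N = (j + k <= J)%N); last by lia.
case: ifP => _; last by rewrite !mulr0.
by congr (_ * h _ + _ * h _); lia.
Qed.

Lemma mod_double P y : (0 < P)%N -> ((2 * y) %% (2 * P) = 2 * (y %% P))%N.
Proof. by move=> _; rewrite -muln_modr. Qed.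

Lemma mod_double1 P y : (0 < P)%N -> ((2 * y + 1) %% (2 * P) = 2 * (y %% P) + 1)%N.
Proof.
move=> P0; rewrite -modnDml mod_double // modn_small //.
by have : (y %% P < P)%N by [rewrite ltn_mod]; lia.
Qed.

(** Reduction modulo the even number [2 * P] keeps parity: even taps meet even columns and odd taps
    odd columns. *)
Lemma entry_polyphase_row P J (w : nat -> R) (a b : nat -> R) r c : (0 < P)%N ->
  (forall j, (j <= J)%N -> w (2 * j)%N = a j) ->
  (forall j, (j <= J)%N -> w (2 * j + 1)%N = b j) ->
  \sum_(i < 2 * J.+1) (if c == ((2 * r + i) %% (2 * P))%N then (w i)%:C else 0)
    = (polyphase_row P a b J 0 r c)%:C :> C.
Proof.
move=> P0 ha hb.
rewrite (sum_pairs _ (fun i => if c == ((2 * r + i) %% (2 * P))%N then (w i)%:C else 0 : C)).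
rewrite /polyphase_row; case: (boolP (odd c)) => oc; rewrite rmorph_sum; apply: eq_bigr => j _ /=;
  have hj : (j <= J)%N by rewrite -ltnS.
  all: rewrite -mulnDr mod_double // addnA -mulnDr mod_double1 // ha // hb //.
  rewrite ifF ?add0r; last by apply/eqP => e; move: oc; rewrite e oddM.
  rewrite addn0 (_ : (c == 2 * ((r + j) %% P) + 1)%N = (c./2 == (r + j) %% P)%N); last by lia.
  by case: ifP; rewrite ?mulr1 // mulr0.
rewrite [X in _ + X]ifF ?addr0; last first.
  by apply/eqP => e; move: oc; rewrite e oddD oddM.
rewrite (_ : (c == 2 * ((r + j) %% P))%N = (c./2 == (r + j) %% P)%N); last by lia.
by case: ifP; rewrite ?mulr1 // mulr0.
Qed.

Lemma wavelet_level_polyphase h n m J P : (0 < P)%N -> (2 * P = 2 ^ m)%N ->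
  wavelet_level (2 * J.+1) h n m = polyphase_mx n P (even_taps J h) (odd_taps J h) J 0.
Proof.
move=> P0 eP; apply/matrixP => r c; rewrite !mxE -eP.
case: ifP => _ //; rewrite /wavelet1_entry -eP mulKn //; case: ifP => _.
  apply: entry_polyphase_row => // j hj; by rewrite /even_taps /odd_taps hj.
apply: entry_polyphase_row => // j hj; rewrite /wavelet_g /even_taps /odd_taps leq_subr.
  rewrite exprM sqrrN !expr1n mul1r; congr h; lia.
rewrite exprD exprM sqrrN !expr1n mul1r expr1 mulN1r; congr (- h _); lia.
Qed.

Lemma impl_wavelet N n m l J (h : nat -> R) : (l < m)%N -> (m <= n)%N -> (n + l + 3 <= N)%N ->
  (J < 2 ^ l)%N -> wavelet_filter (2 * J.+1) h ->
  impl N qbit qbit (5000 * (n + l.+1 * J.+1)) (wavelet_level (2 * J.+1) h n m).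
Proof.
move=> lm mn nN hJ hw.
have P0 : (0 < 2 ^ (m - 1 - l) * 2 ^ l)%N by rewrite muln_gt0 !expn_gt0.
rewrite (@wavelet_level_polyphase h n m J _ P0 (powP lm mn)).
have hz j : (J < j)%N -> even_taps J h j = 0 /\ odd_taps J h j = 0.
  by move=> hj; rewrite /even_taps /odd_taps leqNgt hj.
have hP : (0 + J <= 2 ^ (m - 1 - l) * 2 ^ l)%N.
  by rewrite add0n; apply: leLP; rewrite ?expn_gt0 // ltnW.
have [ls [sl ol ->]] := lattice P0 (powPn lm mn) hz (acorr_filter hw) hP.
by rewrite add0n; apply: impl_level.
Qed.

End Wavelet.

Local Open Scope ring_scope.
Local Open Scope complex_scope.

(** The index of a data state with clean ancillas in the full register is the data index itself. *)
Lemma impl_implements (R : realType) n a k (W : 'M[R[i]]_(2 ^ n)) :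
  impl (n + a) qbit qbit k W ->
  exists cc : circuit R (n + a), [/\ circuit_ok cc, implements cc W & (size cc <= k)%N].
Proof.
move=> [A [cc [ok eA sz]] hA]; exists cc; split => // z x hx; rewrite eA.
have ex : insub (val x) = Some (Ordinal hx) by rewrite insubT.
rewrite [RHS](_ : _ = (V R (n + a) n qbit *m W) z (Ordinal hx)).
  by rewrite -hA mul_V mul_ket /= idx_qbit.
have idxE (y : 'I_(2 ^ n)) : idx (n + a) (qbit y) = y :> nat.
  rewrite /= bval_iota divn1 modn_small //; apply: leq_trans (ltn_ord y) _.
  by rewrite leq_exp2l // leq_addr.
have eqz (y : 'I_(2 ^ n)) : (z == idx (n + a) (qbit y)) = (z == y :> nat).
  by apply/eqP/eqP => [->|e]; [exact: idxE | apply: ord_inj; rewrite idxE].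
rewrite ex !mxE; case: insubP => [z' hz ez|hz].
  rewrite (bigD1 z') //= big1 ?addr0 ?mxE => [|y ny].
    by rewrite eqz -ez eqxx mul1r.
  rewrite mxE eqz (_ : (z == y :> nat) = false) ?mul0r //.
  by apply/eqP => e; case/eqP: ny; apply: ord_inj; rewrite -e -ez.
rewrite big1 // => y _; rewrite mxE eqz.
rewrite (_ : (z == y :> nat) = false) ?mul0r //; apply: contraNF hz => /eqP e.
by rewrite (_ : \val z = y) ?ltn_ord.
Qed.

(** * Gate count *)

Lemma up_log_sqr M : (1 < M)%N -> (up_log 2 M ^ 2 <= 16 * M)%N.
Proof.
(* The shift by 4 makes one doubling dominate each step of the induction, and 16 gives equality at
   [k = 0]. *)
move=> M1; have h k : ((k + 4) ^ 2 <= 16 * 2 ^ k)%N.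
  elim: k => // k IH; rewrite expnS; move: IH; rewrite !expnS !expn0 !muln1.
  by move: (2 ^ k)%N => y; nia.
have := h (up_log 2 M).-1; have := @up_log_gtn 2 M isT M1.
move: (2 ^ (up_log 2 M).-1)%N => y; move: (up_log 2 M) => u; rewrite !expnS !expn0 !muln1; nia.
Qed.

Lemma cost_bound (R : realType) (c M n d s : nat) : (1 < M)%N ->
  (s <= d * (c * (n + up_log 2 M * M)))%N ->
  s%:R <= 4 * c%:R * ((d * n)%:R + d%:R * M%:R * Num.sqrt (M%:R)) :> R.
Proof.
move=> M1 hs; set q := Num.sqrt (M%:R : R).
have hu : (up_log 2 M)%:R <= 4 * q.
  have -> : 4 * q = Num.sqrt ((16 * M)%:R).
    by rewrite natrM sqrtrM ?ler0n // -[16%:R](_ : 4 ^+ 2 = _) ?sqrtr_sqr ?ger0_norm //; ring.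
  rewrite -[leLHS]ger0_norm ?ler0n // -sqrtr_sqr ler_sqrt ?ler0n //.
  by rewrite -natrX ler_nat up_log_sqr.
have hs' : s%:R <= d%:R * (c%:R * (n%:R + (up_log 2 M)%:R * M%:R)) :> R.
  by rewrite -!natrM -natrD -!natrM ler_nat.
apply: le_trans hs' _; rewrite natrM.
have -> : 4 * c%:R * (d%:R * n%:R + d%:R * M%:R * q)
   = d%:R * (c%:R * (4 * n%:R + 4 * q * M%:R)) by ring.
do 2 (apply: ler_wpM2l; first exact: ler0n).
apply: lerD; last by apply: ler_wpM2r; rewrite ?ler0n.
by rewrite -natrM ler_nat leq_pmull.
Qed.

Local Close Scope complex_scope.

Theorem theorem2 (R : realType) :
  exists K : R, 0 < K /\
  forall (M : nat) (h : nat -> R) (n d : nat),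
    ~~ odd M -> (0 < M)%N -> wavelet_filter M h ->
    (0 < d)%N -> (d <= n)%N -> (M <= 2 ^ (n - d + 1))%N ->
    exists cc : circuit R (n + (up_log 2 M + 2)),
      circuit_ok cc /\
      implements cc (qwt M h n d) /\
      (size cc)%:R <= K * ((d * n)%:R + d%:R * M%:R * Num.sqrt (M%:R)).
Proof.
exists (4 * 5000%:R); split; first by rewrite mulr_gt0 ?ltr0n.
move=> M h n d oM M0 hw d0 dn hM.
have M1 : (1 < M)%N by lia.
have [J eM] : exists J, M = (2 * J.+1)%N by exists (M./2).-1; lia.
have u0 : (0 < up_log 2 M)%N by rewrite up_log_gt0.
(* The least [l] with [2 ^ l >= M / 2]; the [l + 3] ancillas of a level are then exactly the
   [up_log 2 M + 2] at hand. *)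
pose l := (up_log 2 M).-1.
have eu : up_log 2 M = l.+1 by rewrite /l prednK.
have hJ : (J < 2 ^ l)%N.
  by have := @up_logP 2 M isT; rewrite eu eM expnS; lia.
(* The last level acts on the fewest qubits, [n - d + 1], and a block must still fit into it. *)
have lm : (l < n - d + 1)%N by rewrite -eu; apply: up_log_min.
have key d' : (d' <= d)%N ->
    impl (n + (up_log 2 M + 2)) qbit qbit (d' * (5000 * (n + l.+1 * J.+1))) (qwt M h n d').
  elim: d' => [|d' IH] hd; first exact: (@impl_id R _ n qbit qbit [::]).
  rewrite /= mulSnr; apply: impl_mul (IH (ltnW hd)) _.
  rewrite eM; apply: impl_wavelet; rewrite -?eM //; lia.
have [cc [ok im sz]] := impl_implements (key d (leqnn d)).
exists cc; split; first exact: ok.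
split; first exact: im.
apply: (cost_bound _ M1); apply: leq_trans sz _.
rewrite leq_mul2l leq_mul2l leq_add2l -eu leq_mul2l; lia.
Qed.
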